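(* A function $g:\mathbb D\to\mathbb C$ is bounded and holomorphic on $\mathbb D$ if and only if there exist $M>0$ and a Blaschke function $f$ such that the function $\Delta_f:\mathbb D\times\mathbb D\to\mathbb C$ defined by $$\Delta_f(z,w)=M^2\alpha^2\,k(z,w)-g(z)\,k(f(z),f(w))\,\overline{g(w)}$$ is a positive semi-definite kernel, where $k(z,w)=(1-z\overline w)^{-1}$ is the Szeg\''o kernel and $\alpha^2=(1+|f(0)|)(1-|f(0)|)^{-1}$.
   Context: $\mathbb D$ is the open unit disk. A Blaschke function is a finite Blaschke product $f(z)=e^{i\theta}\prod_{j=1}^N\frac{z-a_j}{1-\overline{a_j}z}$ with $N\ge 1$, $\theta\in\mathbb R$, $a_j\in\mathbb D$. A function $\Delta:\mathbb D\times\mathbb D\to\mathbb C$ is a positive semi-definite kernel if $\sum_{i,j=1}^m\Delta(z_i,z_j)c_j\overline{c_i}\ge 0$ for all $m\ge1$, $z_1,\dots,z_m\in\mathbb D$, $c_1,\dots,c_m\in\mathbb C$. *)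

(* Defs.v *)
(* Stdlib reals with Coquelicot.  Functions on the unit disk are represented by
   total functions on C; every notion below only looks at their values on the
   disk (which is open, so complex differentiability there is unaffected). *)
From Stdlib Require Import Reals List.
From Coquelicot Require Import Coquelicot.

Local Open Scope C_scope.

Definition unit_disk (z : C) : Prop := (Cmod z < 1)%R.

Definition holomorphic_on_disk (g : C -> C) : Prop :=
  forall z : C, unit_disk z -> @ex_derive C_AbsRing C_NormedModule g z.

Definition bounded_on_disk (g : C -> C) : Prop :=
  exists B : R, forall z : C, unit_disk z -> (Cmod (g z) <= B)%R.

Definition Cexp_i (theta : R) : C := (cos theta, sin theta).

(* [zeros] is the list a_1, ..., a_N, repetitions allowed. *)
Definition blaschke_product (theta : R) (zeros : list C) (z : C) : C :=
  Cexp_i theta *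
  fold_right Cmult 1 (map (fun a : C => (z - a) / (1 - Cconj a * z)) zeros).

Definition is_blaschke (f : C -> C) : Prop :=
  exists (theta : R) (zeros : list C),
    (1 <= length zeros)%nat /\
    (forall a : C, In a zeros -> unit_disk a) /\
    (forall z : C, unit_disk z -> f z = blaschke_product theta zeros z).

(* The order on C for which being nonnegative entails being real. *)
Definition Cnonneg (x : C) : Prop := Im x = 0%R /\ (0 <= Re x)%R.

(* [sum_n u n] is u 0 + ... + u n, so the nonempty family of m = n + 1 points is
   z 0, ..., z n. *)
Definition psd_kernel_on_disk (K : C -> C -> C) : Prop :=
  forall (n : nat) (z c : nat -> C),
    (forall i : nat, (i <= n)%nat -> unit_disk (z i)) ->
    Cnonneg
      (sum_n (fun i : nat =>
         sum_n (fun j : nat => K (z i) (z j) * c j * Cconj (c i)) n) n).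

Definition szego (z w : C) : C := / (1 - z * Cconj w).

Definition alpha_sq (f : C -> C) : R :=
  ((1 + Cmod (f (RtoC 0))) / (1 - Cmod (f (RtoC 0))))%R.

Definition Delta_kernel (M : R) (g f : C -> C) (z w : C) : C :=
  RtoC (M ^ 2 * alpha_sq f) * szego z w
  - g z * szego (f z) (f w) * Cconj (g w).

(* Main.v *)
(* If Delta_f is positive semi-definite, its diagonal bounds |g|^2 by a multiple of
   (1 - |f|^2) / (1 - |z|^2), which is bounded for a Blaschke f.  Since k(f, f) - 1 is
   positive semi-definite, so is C k - g conj(g); testing this on the points z, z + h, z + h'
   shows that the slopes of g at z are Lipschitz in the increment, so g'(z) exists.

   Conversely take f = id.  A Goursat bisection gives the reproducing formula
   F(w) = (1/2pi) int F(e^{it}) conj(k(e^{it}, w)) dt without assuming F' continuous.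
   Multiplication by a function bounded by M then has norm at most M for the L^2 norm on the
   circle, which by the reproducing formula is the positivity of (M^2 - g conj(g)) k, first
   for g(r z) with r < 1, then in the limit r -> 1. *)
Require Import Defs.
From Stdlib Require Import Reals List Lra Lia Psatz IndefiniteDescription.
From Coquelicot Require Import Coquelicot.

Local Open Scope C_scope.

(** * Continuity and complex differentiability *)

Lemma Cmod_le_Re_Im (z : C) : (Cmod z <= Rabs (Re z) + Rabs (Im z))%R.
Proof.
apply Rsqr_incr_0_var; [|apply Rplus_le_le_0_compat; apply Rabs_pos].
replace (Rsqr (Cmod z)) with (Re z ^ 2 + Im z ^ 2)%R
  by (rewrite <- Cmod2_alt; unfold Rsqr; ring).
pose proof (Rabs_pos (Re z)); pose proof (Rabs_pos (Im z)).
rewrite <- (pow2_abs (Re z)), <- (pow2_abs (Im z)).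
unfold Rsqr; nra.
Qed.

Lemma Im_le_Cmod (z : C) : (Rabs (Im z) <= Cmod z)%R.
Proof. exact (Rle_trans _ _ _ (Rmax_r _ _) (Rmax_Cmod z)). Qed.

Lemma Cmod_sub_ge (x y : C) : (Cmod x - Cmod y <= Cmod (x - y))%R.
Proof.
assert (H := Cmod_triangle (x - y) y).
replace (x - y + y) with x in H by ring. lra.
Qed.

Lemma Cmod_sub_sym (x y : C) : Cmod (x - y) = Cmod (y - x).
Proof. rewrite <- Cmod_opp; f_equal; ring. Qed.

Definition Ccontinuous (f : R -> C) (t : R) : Prop :=
  @continuous R_UniformSpace (AbsRing_UniformSpace C_AbsRing) f t.

Definition Cdifferentiable (F : C -> C) (z : C) : Prop :=
  @ex_derive C_AbsRing (AbsRing_NormedModule C_AbsRing) F z.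

Lemma holomorphic_differentiable (F : C -> C) (z : C) :
  @ex_derive C_AbsRing C_NormedModule F z <-> Cdifferentiable F z.
Proof.
split; intros [l [_ Hl]]; exists l; (split; [apply is_linear_scal_l | exact Hl]).
Qed.

Lemma Cdifferentiable_eps (F : C -> C) (z : C) :
  Cdifferentiable F z <->
  exists l : C, forall eps : R, (0 < eps)%R -> exists delta : R, (0 < delta)%R /\
    forall u : C, (Cmod (u - z) < delta)%R ->
      (Cmod (F u - F z - l * (u - z)) <= eps * Cmod (u - z))%R.
Proof.
split.
- intros [l [_ Hl]]; exists l; intros eps Heps.
  destruct (Hl z (fun P H => H) (mkposreal eps Heps)) as [d Hd].
  exists d; split; [apply cond_pos|]; intros u Hu.
  replace (F u - F z - l * (u - z)) with (F u - F z - (u - z) * l) by ring.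
  exact (Hd u Hu).
- intros [l Hl]; exists l; split; [apply is_linear_scal_l|].
  intros x Hx eps; apply (is_filter_lim_locally_unique (V := AbsRing_NormedModule C_AbsRing)) in Hx; subst x.
  destruct (Hl eps (cond_pos eps)) as [d [Hd0 Hd]].
  exists (mkposreal d Hd0); intros u Hu.
  specialize (Hd u Hu).
  replace (F u - F z - l * (u - z)) with (F u - F z - (u - z) * l) in Hd by ring.
  exact Hd.
Qed.

Lemma Ccontinuous_eps (f : R -> C) (t : R) :
  Ccontinuous f t <->
  forall eps : R, (0 < eps)%R -> exists delta : R, (0 < delta)%R /\
    forall s : R, (Rabs (s - t) < delta)%R -> (Cmod (f s - f t) < eps)%R.
Proof.
split.
- intros H eps Heps.
  destruct (H _ (locally_ball (T := AbsRing_UniformSpace C_AbsRing) (f t) (mkposreal eps Heps))) as [d Hd].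
  exists d; split; [apply cond_pos|]; intros s Hs; exact (Hd s Hs).
- intros H P [eps HP].
  destruct (H eps (cond_pos eps)) as [d [Hd0 Hd]].
  exists (mkposreal d Hd0); intros s Hs; apply HP, (Hd s Hs).
Qed.

Lemma Ccontinuous_const (c : C) (t : R) : Ccontinuous (fun _ => c) t.
Proof. apply continuous_const. Qed.

Lemma Ccontinuous_plus (f g : R -> C) (t : R) :
  Ccontinuous f t -> Ccontinuous g t -> Ccontinuous (fun s => f s + g s) t.
Proof.
exact (continuous_plus (V := AbsRing_NormedModule C_AbsRing) f g t).
Qed.

Lemma Ccontinuous_mult (f g : R -> C) (t : R) :
  Ccontinuous f t -> Ccontinuous g t -> Ccontinuous (fun s => f s * g s) t.
Proof. exact (continuous_mult (K := C_AbsRing) f g t). Qed.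

Lemma Ccontinuous_comp (F : C -> C) (f : R -> C) (t : R) :
  Cdifferentiable F (f t) -> Ccontinuous f t -> Ccontinuous (fun s => F (f s)) t.
Proof.
intros HF Hf.
apply (continuous_comp (U := R_UniformSpace) (V := AbsRing_UniformSpace C_AbsRing)
  (W := AbsRing_UniformSpace C_AbsRing) f F t Hf).
exact (ex_derive_continuous (V := AbsRing_NormedModule C_AbsRing) F (f t) HF).
Qed.

Lemma Ccontinuous_of_parts (f : R -> C) (t : R) :
  continuous (fun s => Re (f s)) t -> continuous (fun s => Im (f s)) t ->
  Ccontinuous f t.
Proof.
intros H1 H2; apply Ccontinuous_eps; intros eps Heps.
assert (He : (0 < eps / 2)%R) by lra.
destruct (H1 _ (locally_ball _ (mkposreal _ He))) as [d1 Hd1].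
destruct (H2 _ (locally_ball _ (mkposreal _ He))) as [d2 Hd2].
exists (Rmin d1 d2); split; [apply Rmin_pos; apply cond_pos|]; intros s Hs.
assert (A1 : (Rabs (Re (f s) - Re (f t)) < eps / 2)%R)
  by (apply Hd1; exact (Rlt_le_trans _ _ _ Hs (Rmin_l _ _))).
assert (A2 : (Rabs (Im (f s) - Im (f t)) < eps / 2)%R)
  by (apply Hd2; exact (Rlt_le_trans _ _ _ Hs (Rmin_r _ _))).
eapply Rle_lt_trans; [apply Cmod_le_Re_Im|].
unfold Cminus; rewrite re_plus, im_plus, re_opp, im_opp; unfold Rminus in A1, A2; lra.
Qed.

Lemma Ccontinuous_Re (f : R -> C) (t : R) :
  Ccontinuous f t -> continuous (fun s => Re (f s)) t.
Proof.
intros H P [eps HP].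
destruct (proj1 (Ccontinuous_eps f t) H eps (cond_pos eps)) as [d [Hd0 Hd]].
exists (mkposreal d Hd0); intros s Hs; apply HP.
eapply Rle_lt_trans; [|apply (Hd s Hs)].
eapply Rle_trans; [|apply re_le_Cmod].
unfold Cminus; rewrite re_plus, re_opp; apply Rle_refl.
Qed.

Lemma Ccontinuous_Im (f : R -> C) (t : R) :
  Ccontinuous f t -> continuous (fun s => Im (f s)) t.
Proof.
intros H P [eps HP].
destruct (proj1 (Ccontinuous_eps f t) H eps (cond_pos eps)) as [d [Hd0 Hd]].
exists (mkposreal d Hd0); intros s Hs; apply HP.
eapply Rle_lt_trans; [|apply (Hd s Hs)].
eapply Rle_trans; [|apply Im_le_Cmod].
unfold Cminus; rewrite im_plus, im_opp; apply Rle_refl.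
Qed.

Lemma Cdifferentiable_ext (F G : C -> C) (z : C) :
  (forall u : C, F u = G u) -> Cdifferentiable F z -> Cdifferentiable G z.
Proof. intros E; exact (ex_derive_ext (V := AbsRing_NormedModule C_AbsRing) F G z E). Qed.

Lemma Cdifferentiable_const (c z : C) : Cdifferentiable (fun _ => c) z.
Proof. apply ex_derive_const. Qed.

Lemma Cdifferentiable_id (z : C) : Cdifferentiable (fun u => u) z.
Proof. apply ex_derive_id. Qed.

Lemma Cdifferentiable_plus (F G : C -> C) (z : C) :
  Cdifferentiable F z -> Cdifferentiable G z -> Cdifferentiable (fun u => F u + G u) z.
Proof. exact (ex_derive_plus (V := AbsRing_NormedModule C_AbsRing) F G z). Qed.

Lemma Cdifferentiable_mult (F G : C -> C) (z : C) :
  Cdifferentiable F z -> Cdifferentiable G z -> Cdifferentiable (fun u => F u * G u) z.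
Proof.
intros [l Hl] [m Hm]; eexists.
apply (is_derive_mult (K := C_AbsRing) F G z l m Hl Hm), Cmult_comm.
Qed.

Lemma Cdifferentiable_comp (F G : C -> C) (z : C) :
  Cdifferentiable F (G z) -> Cdifferentiable G z -> Cdifferentiable (fun u => F (G u)) z.
Proof. exact (ex_derive_comp (V := AbsRing_NormedModule C_AbsRing) F G z). Qed.

Lemma Cdifferentiable_sum_n (F : nat -> C -> C) (n : nat) (z : C) :
  (forall i, (i <= n)%nat -> Cdifferentiable (F i) z) ->
  Cdifferentiable (fun u => sum_n (fun i => F i u) n) z.
Proof.
induction n as [|n IH]; intros H.
- destruct (H 0%nat (le_n _)) as [l Hl]; exists l.
  eapply is_derive_ext; [|exact Hl]; intros u; now rewrite sum_O.
- assert (D : Cdifferentiable (fun u => sum_n (fun i => F i u) n + F (S n) u) z)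
    by (apply Cdifferentiable_plus; [apply IH; intros i Hi|]; apply H; lia).
  destruct D as [l Hl]; exists l.
  eapply is_derive_ext; [|exact Hl]; intros u; now rewrite sum_Sn.
Qed.

Lemma Cdifferentiable_inv (z : C) : z <> 0 -> Cdifferentiable Cinv z.
Proof.
intros Hz; apply Cdifferentiable_eps.
assert (Hm : (0 < Cmod z)%R) by now apply Cmod_gt_0.
exists (- (/ z * / z)); intros eps Heps.
set (m := Cmod z) in *.
exists (Rmin (m / 2) (eps * m ^ 3 / 2)); split.
{ apply Rmin_pos; [lra|]. assert (0 < m ^ 3)%R by now apply pow_lt. nra. }
intros u Hu.
assert (H1 : (Cmod (u - z) < m / 2)%R) by exact (Rlt_le_trans _ _ _ Hu (Rmin_l _ _)).
assert (H2 : (Cmod (u - z) < eps * m ^ 3 / 2)%R) by exact (Rlt_le_trans _ _ _ Hu (Rmin_r _ _)).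
assert (H3 : (m / 2 <= Cmod u)%R).
{ assert (H := Cmod_sub_ge z u); rewrite Cmod_sub_sym in H; fold m in H; lra. }
assert (Hu0 : u <> 0) by (apply Cmod_gt_0; lra).
replace (/ u - / z - - (/ z * / z) * (u - z)) with ((u - z) * ((u - z) / (u * z * z)))
  by (field; auto).
rewrite Cmod_mult, Cmod_div, !Cmod_mult; fold m.
2:{ repeat apply Cmult_neq_0; auto. }
rewrite (Rmult_comm eps); apply Rmult_le_compat_l; [apply Cmod_ge_0|].
assert (0 < m * m)%R by nra.
apply Rle_div_l; [apply Rmult_lt_0_compat; [apply Rmult_lt_0_compat|]; lra|].
apply Rle_trans with (eps * m ^ 3 / 2)%R; [lra|].
assert (0 <= eps * (m * m) * (Cmod u - m / 2))%R by (apply Rmult_le_pos; [apply Rmult_le_pos|]; lra).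
simpl; lra.
Qed.

Lemma one_sub_neq_0 (x : C) : (Cmod x < 1)%R -> 1 - x <> 0.
Proof.
intros H E; assert (H' := Cmod_sub_ge 1 x).
rewrite E, Cmod_0, Cmod_1 in H'; lra.
Qed.

Lemma szego_differentiable (w z : C) :
  unit_disk w -> (Cmod z <= 1)%R -> Cdifferentiable (fun u => szego u w) z.
Proof.
unfold unit_disk; intros Hw Hz.
apply (Cdifferentiable_comp Cinv (fun u => 1 - u * Cconj w)).
- apply Cdifferentiable_inv, one_sub_neq_0.
  rewrite Cmod_mult, Cmod_conj; pose proof (Cmod_ge_0 z); pose proof (Cmod_ge_0 w); nra.
- apply (Cdifferentiable_ext (fun u => 1 + u * - Cconj w)); [intros u; ring|].
  apply (Cdifferentiable_plus (fun _ => 1)); [apply Cdifferentiable_const|].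
  apply (Cdifferentiable_mult (fun u => u)); [apply Cdifferentiable_id|].
  apply Cdifferentiable_const.
Qed.

(** * Complex integrals and bisection *)

Definition is_CInt (f : R -> C) (a b : R) (l : C) : Prop :=
  is_RInt (fun t => Re (f t)) a b (Re l) /\ is_RInt (fun t => Im (f t)) a b (Im l).

Lemma is_CInt_ext (f g : R -> C) (a b : R) (l : C) :
  (forall t, (Rmin a b < t < Rmax a b)%R -> f t = g t) ->
  is_CInt f a b l -> is_CInt g a b l.
Proof.
intros E [H1 H2]; split.
- eapply is_RInt_ext; [|exact H1]; intros t Ht; cbv beta; now rewrite E.
- eapply is_RInt_ext; [|exact H2]; intros t Ht; cbv beta; now rewrite E.
Qed.

Lemma is_CInt_unique (f : R -> C) (a b : R) (l m : C) :
  is_CInt f a b l -> is_CInt f a b m -> l = m.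
Proof.
intros [H1 H2] [H3 H4].
apply (is_RInt_unique (V := R_CompleteNormedModule)) in H1, H2, H3, H4.
rewrite (surjective_pairing l), (surjective_pairing m).
f_equal; [change (Re l = Re m)|change (Im l = Im m)]; congruence.
Qed.

Lemma is_CInt_plus (f g : R -> C) (a b : R) (l m : C) :
  is_CInt f a b l -> is_CInt g a b m -> is_CInt (fun t => f t + g t) a b (l + m).
Proof.
intros [H1 H2] [H3 H4]; split.
- exact (is_RInt_plus _ _ _ _ _ _ H1 H3).
- exact (is_RInt_plus _ _ _ _ _ _ H2 H4).
Qed.

Lemma is_CInt_scal (c : C) (f : R -> C) (a b : R) (l : C) :
  is_CInt f a b l -> is_CInt (fun t => c * f t) a b (c * l).
Proof.
intros [H1 H2]; split.
- exact (is_RInt_minus _ _ _ _ _ _ (is_RInt_scal _ _ _ (Re c) _ H1)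
    (is_RInt_scal _ _ _ (Im c) _ H2)).
- exact (is_RInt_plus _ _ _ _ _ _ (is_RInt_scal _ _ _ (Re c) _ H2)
    (is_RInt_scal _ _ _ (Im c) _ H1)).
Qed.

Lemma is_CInt_minus (f g : R -> C) (a b : R) (l m : C) :
  is_CInt f a b l -> is_CInt g a b m -> is_CInt (fun t => f t - g t) a b (l - m).
Proof.
intros [H1 H2] [H3 H4]; split.
- exact (is_RInt_minus _ _ _ _ _ _ H1 H3).
- exact (is_RInt_minus _ _ _ _ _ _ H2 H4).
Qed.

Lemma is_CInt_conj (f : R -> C) (a b : R) (l : C) :
  is_CInt f a b l -> is_CInt (fun t => Cconj (f t)) a b (Cconj l).
Proof.
intros [H1 H2]; split; [exact H1|exact (is_RInt_opp _ _ _ _ H2)].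
Qed.

Lemma is_CInt_const (c : C) (a b : R) : is_CInt (fun _ => c) a b (RtoC (b - a) * c).
Proof.
split.
- replace (Re (RtoC (b - a) * c)) with (scal (b - a)%R (Re c))
    by (change ((b - a) * fst c = (b - a) * fst c - 0 * snd c)%R; ring).
  apply (is_RInt_const (V := R_NormedModule)).
- replace (Im (RtoC (b - a) * c)) with (scal (b - a)%R (Im c))
    by (change ((b - a) * snd c = (b - a) * snd c + 0 * fst c)%R; ring).
  apply (is_RInt_const (V := R_NormedModule)).
Qed.

Lemma is_CInt_sum_n (f : nat -> R -> C) (a b : R) (l : nat -> C) (n : nat) :
  (forall i, (i <= n)%nat -> is_CInt (f i) a b (l i)) ->
  is_CInt (fun t => sum_n (fun i => f i t) n) a b (sum_n l n).
Proof.
induction n as [|n IH]; intros H.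
- rewrite sum_O; eapply is_CInt_ext; [|exact (H 0%nat (le_n _))].
  intros t _; now rewrite sum_O.
- rewrite sum_Sn; eapply is_CInt_ext.
  + intros t _; symmetry; apply sum_Sn.
  + apply (is_CInt_plus (fun t => sum_n (fun i => f i t) n) (f (S n)));
      [apply IH; intros i Hi|]; apply H; lia.
Qed.

Lemma is_CInt_Chasles (f : R -> C) (a b c : R) (l m : C) :
  is_CInt f a b l -> is_CInt f b c m -> is_CInt f a c (l + m).
Proof.
intros [H1 H2] [H3 H4]; split.
- exact (is_RInt_Chasles _ _ _ _ _ _ H1 H3).
- exact (is_RInt_Chasles _ _ _ _ _ _ H2 H4).
Qed.

Definition CInt (f : R -> C) (a b : R) : C :=
  (RInt (fun t => Re (f t)) a b, RInt (fun t => Im (f t)) a b).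

Lemma CInt_correct (f : R -> C) (a b : R) :
  (a <= b)%R -> (forall t, (a <= t <= b)%R -> Ccontinuous f t) ->
  is_CInt f a b (CInt f a b).
Proof.
intros Hab H; split; apply (RInt_correct (V := R_CompleteNormedModule));
  apply (ex_RInt_continuous (V := R_CompleteNormedModule)); intros t Ht;
  rewrite Rmin_left, Rmax_right in Ht by assumption.
- now apply Ccontinuous_Re, H.
- now apply Ccontinuous_Im, H.
Qed.

Lemma is_CInt_Cmod_le (f : R -> C) (a b e : R) (l : C) :
  (a <= b)%R -> (forall t, (a <= t <= b)%R -> (Cmod (f t) <= e)%R) ->
  is_CInt f a b l -> (Cmod l <= 2 * e * (b - a))%R.
Proof.
intros Hab H [H1 H2].
eapply Rle_trans; [apply Cmod_le_Re_Im|].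
rewrite <- (is_RInt_unique (V := R_CompleteNormedModule) _ _ _ _ H1).
rewrite <- (is_RInt_unique (V := R_CompleteNormedModule) _ _ _ _ H2).
replace (2 * e * (b - a))%R with ((b - a) * e + (b - a) * e)%R by ring.
apply Rplus_le_compat; apply abs_RInt_le_const; auto; try (eexists; eassumption).
- intros t Ht; eapply Rle_trans; [apply re_le_Cmod|now apply H].
- intros t Ht; eapply Rle_trans; [apply Im_le_Cmod|now apply H].
Qed.

Lemma is_CInt_Re_ge_0 (f : R -> C) (a b : R) (l : C) :
  (a <= b)%R -> (forall t, (0 <= Re (f t))%R) -> is_CInt f a b l -> (0 <= Re l)%R.
Proof.
intros Hab H [H1 _].
rewrite <- (is_RInt_unique (V := R_CompleteNormedModule) _ _ _ _ H1).
apply RInt_ge_0; auto; eexists; eassumption.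
Qed.

Lemma is_CInt_Im_0 (f : R -> C) (a b : R) (l : C) :
  (forall t, Im (f t) = 0%R) -> is_CInt f a b l -> Im l = 0%R.
Proof.
intros H [_ H2].
rewrite <- (is_RInt_unique (V := R_CompleteNormedModule) _ _ _ _ H2).
rewrite (RInt_ext _ (fun _ => 0%R)); [|intros t _; apply H].
rewrite RInt_const; apply Rmult_0_r.
Qed.

Lemma Goursat_bisection (mu : R -> R -> R -> C) (a0 b0 s0 : R) :
  (0 < s0)%R ->
  (forall a b s, (a0 <= a)%R -> (b0 <= b)%R -> (0 < s)%R ->
     (a + (s + s) <= a0 + s0)%R -> (b + (s + s) <= b0 + s0)%R ->
     mu a b (s + s)%R
     = mu a b s + mu (a + s)%R b s + mu a (b + s)%R s + mu (a + s)%R (b + s)%R s) ->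
  (forall x y eps, (a0 <= x <= a0 + s0)%R -> (b0 <= y <= b0 + s0)%R -> (0 < eps)%R ->
     exists delta, (0 < delta)%R /\
     forall a b s, (0 < s < delta)%R ->
       (a0 <= a)%R -> (a <= x <= a + s)%R -> (a + s <= a0 + s0)%R ->
       (b0 <= b)%R -> (b <= y <= b + s)%R -> (b + s <= b0 + s0)%R ->
       (Cmod (mu a b s) <= eps * (s * s))%R) ->
  mu a0 b0 s0 = 0.
Proof.
intros Hs0 Hadd Hloc.
apply Cmod_eq_0; destruct (Req_dec (Cmod (mu a0 b0 s0)) 0) as [E|Hne]; [exact E|exfalso].
assert (Hpos : (0 < Cmod (mu a0 b0 s0))%R) by (pose proof (Cmod_ge_0 (mu a0 b0 s0)); lra).
set (eta := (Cmod (mu a0 b0 s0) / (s0 * s0))%R).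
assert (Heta : (0 < eta)%R) by (apply Rdiv_lt_0_compat; nra).
set (s := fun n : nat => (s0 / 2 ^ n)%R).
assert (Hs : forall n, (0 < s n)%R)
  by (intros n; apply Rdiv_lt_0_compat; [lra|apply pow_lt; lra]).
assert (HsS : forall n, (s (S n) + s (S n) = s n)%R).
{ intros n; unfold s; simpl; field; apply pow_nonzero; lra. }
set (good := fun n (p : R * R) =>
  (a0 <= fst p)%R /\ (b0 <= snd p)%R /\ (fst p + s n <= a0 + s0)%R /\
  (snd p + s n <= b0 + s0)%R /\ (eta * (s n * s n) <= Cmod (mu (fst p) (snd p) (s n)))%R).
assert (Hstep : forall n p, good n p -> exists q, good (S n) q /\
  (fst p <= fst q)%R /\ (snd p <= snd q)%R /\
  (fst q + s (S n) <= fst p + s n)%R /\ (snd q + s (S n) <= snd p + s n)%R).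
{ intros n [a b] (G1 & G2 & G3 & G4 & G5); simpl in *.
  pose proof (Hs (S n)) as Hsn; pose proof (HsS n) as HSn.
  set (h := s (S n)) in *.
  assert (H := Hadd a b h G1 G2 Hsn ltac:(lra) ltac:(lra)).
  rewrite HSn in H.
  assert (Ht : (Cmod (mu a b (s n)) <=
    Cmod (mu a b h) + Cmod (mu (a + h)%R b h)
    + Cmod (mu a (b + h)%R h) + Cmod (mu (a + h)%R (b + h)%R h))%R).
  { rewrite H; eapply Rle_trans; [apply Cmod_triangle|apply Rplus_le_compat_r].
    eapply Rle_trans; [apply Cmod_triangle|apply Rplus_le_compat_r].
    apply Cmod_triangle. }
  rewrite <- HSn in G5 at 1 2.
  unfold good; fold h.
  destruct (Rle_dec (eta * (h * h)) (Cmod (mu a b h))) as [K1|K1];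
    [exists (a, b); simpl; repeat split; lra|].
  destruct (Rle_dec (eta * (h * h)) (Cmod (mu (a + h)%R b h))) as [K2|K2];
    [exists ((a + h)%R, b); simpl; repeat split; lra|].
  destruct (Rle_dec (eta * (h * h)) (Cmod (mu a (b + h)%R h))) as [K3|K3];
    [exists (a, (b + h)%R); simpl; repeat split; lra|].
  exists ((a + h)%R, (b + h)%R); simpl; repeat split; lra. }
assert (Hseq : exists p : nat -> R * R, forall n, good n (p n) /\
  (fst (p n) <= fst (p (S n)))%R /\ (snd (p n) <= snd (p (S n)))%R /\
  (fst (p (S n)) + s (S n) <= fst (p n) + s n)%R /\
  (snd (p (S n)) + s (S n) <= snd (p n) + s n)%R).
{ assert (Hstep' : forall n (p : {p | good n p}), {q : {q | good (S n) q} |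
    (fst (proj1_sig p) <= fst (proj1_sig q))%R /\
    (snd (proj1_sig p) <= snd (proj1_sig q))%R /\
    (fst (proj1_sig q) + s (S n) <= fst (proj1_sig p) + s n)%R /\
    (snd (proj1_sig q) + s (S n) <= snd (proj1_sig p) + s n)%R}).
  { intros n [p Hp]; apply constructive_indefinite_description.
    destruct (Hstep n p Hp) as [q [Hq H]]; exists (exist _ q Hq); exact H. }
  assert (G0 : good 0%nat (a0, b0)).
  { unfold good, s; simpl; rewrite Rdiv_1_r; repeat split; try lra.
    unfold eta; right; field; lra. }
  set (P := nat_rect (fun n => {p | good n p}) (exist _ (a0, b0) G0)
    (fun n p => proj1_sig (Hstep' n p))).
  exists (fun n => proj1_sig (P n)); intros n; split; [exact (proj2_sig (P n))|].
  exact (proj2_sig (Hstep' n (P n))). }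
destruct Hseq as [p Hp].
assert (Hnest : forall u : nat -> R, (forall n, (u n <= u (S n))%R /\
  (u (S n) + s (S n) <= u n + s n)%R) -> exists x, forall n, (u n <= x <= u n + s n)%R).
{ intros u Hu.
  assert (Hup : forall k n, (u n <= u (n + k)%nat)%R /\
    (u (n + k)%nat + s (n + k)%nat <= u n + s n)%R).
  { induction k as [|k IH]; intros n; [rewrite Nat.add_0_r; lra|].
    rewrite Nat.add_succ_r; specialize (IH n); specialize (Hu (n + k)%nat); lra. }
  assert (Hle : forall m n, (u m <= u n + s n)%R).
  { intros m n; pose proof (Hs (n + m)%nat).
    pose proof (Hup m n); pose proof (Hup n m); rewrite (Nat.add_comm m n) in *; lra. }
  destruct (completeness (fun x => exists n, x = u n)) as [x [Hx1 Hx2]].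
  - exists (u 0%nat + s 0%nat)%R; intros y [n ->]; apply Hle.
  - now exists (u 0%nat), 0%nat.
  - exists x; intros n; split; [apply Hx1; now exists n|].
    apply Hx2; intros y [m ->]; apply Hle. }
destruct (Hnest (fun n => fst (p n))) as [x Hx]; [intros n; split; apply (Hp n)|].
destruct (Hnest (fun n => snd (p n))) as [y Hy]; [intros n; split; apply (Hp n)|].
destruct (Hloc x y (eta / 2)%R) as [d [Hd0 Hd]]; [| |lra|].
- destruct (Hp 0%nat) as [(G1 & G2 & G3 & G4 & G5) _]; specialize (Hx 0%nat); lra.
- destruct (Hp 0%nat) as [(G1 & G2 & G3 & G4 & G5) _]; specialize (Hy 0%nat); lra.
- assert (Hn : exists n, (s n < d)%R).
  { destruct (pow_lt_1_zero (/ 2) ltac:(rewrite Rabs_pos_eq; lra) (d / s0)) as [N HN];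
      [now apply Rdiv_lt_0_compat|].
    exists N; specialize (HN N (le_n _)).
    rewrite Rabs_pos_eq in HN by (apply pow_le; lra).
    rewrite pow_inv in HN; apply (Rmult_lt_compat_l s0) in HN; [|lra].
    replace (s0 * (d / s0))%R with d in HN by (field; lra); exact HN. }
  destruct Hn as [n Hn].
  destruct (Hp n) as [(G1 & G2 & G3 & G4 & G5) _].
  specialize (Hd (fst (p n)) (snd (p n)) (s n) (conj (Hs n) Hn) G1 (Hx n) G3 G2 (Hy n) G4).
  assert (0 < s n * s n)%R by (pose proof (Hs n); nra).
  nra.
Qed.

(** * The reproducing formula *)

Lemma Cexp_i_Cmod (t : R) : Cmod (Cexp_i t) = 1%R.
Proof.
unfold Cmod, Cexp_i; simpl.
replace (cos t * (cos t * 1) + sin t * (sin t * 1))%R with 1%R; [apply sqrt_1|].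
pose proof (sin2_cos2 t) as H; unfold Rsqr in H; lra.
Qed.

Lemma Cexp_i_conj (t : R) : Cexp_i t * Cconj (Cexp_i t) = 1.
Proof. rewrite <- Cmod2_conj, Cexp_i_Cmod; f_equal; ring. Qed.

Lemma Cexp_i_Lipschitz (s t : R) : (Cmod (Cexp_i s - Cexp_i t) <= 2 * Rabs (s - t))%R.
Proof.
eapply Rle_trans; [apply Cmod_le_Re_Im|].
assert (Hc : (Rabs (cos s - cos t) <= Rabs (s - t))%R).
{ destruct (MVT_gen cos t s (fun x => - sin x)%R) as [x [_ Hx]].
  - intros x _; auto_derive; [exact I|ring].
  - intros x _; apply continuity_cos.
  - rewrite Hx, Rabs_mult, Rabs_Ropp.
    pose proof (Rabs_pos (s - t)).
    assert (Rabs (sin x) <= 1)%R by (apply Rabs_le; pose proof (SIN_bound x); lra).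
    nra. }
assert (Hs : (Rabs (sin s - sin t) <= Rabs (s - t))%R).
{ destruct (MVT_gen sin t s cos) as [x [_ Hx]].
  - intros x _; auto_derive; [exact I|ring].
  - intros x _; apply continuity_sin.
  - rewrite Hx, Rabs_mult.
    pose proof (Rabs_pos (s - t)).
    assert (Rabs (cos x) <= 1)%R by (apply Rabs_le; pose proof (COS_bound x); lra).
    nra. }
unfold Cexp_i, Re, Im; simpl.
change (Rabs (cos s - cos t) + Rabs (sin s - sin t) <= 2 * Rabs (s - t))%R; lra.
Qed.

Lemma exp_le_1 (x : R) : (x <= 0)%R -> (exp x <= 1)%R.
Proof.
intros [H|H]; rewrite <- exp_0; [left; now apply exp_increasing|rewrite H; apply Rle_refl].
Qed.

Lemma exp_Lipschitz (s t : R) :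
  (s <= 0)%R -> (t <= 0)%R -> (Rabs (exp s - exp t) <= Rabs (s - t))%R.
Proof.
intros Hs Ht; destruct (MVT_gen exp t s exp) as [x [Hx1 Hx]].
- intros x _; auto_derive; [exact I|ring].
- intros x _; apply derivable_continuous_pt, derivable_pt_exp.
- rewrite Hx, Rabs_mult, (Rabs_pos_eq (exp x)) by (left; apply exp_pos).
  assert (exp x <= 1)%R
    by (apply exp_le_1; eapply Rle_trans; [apply Hx1|]; now apply Rmax_lub).
  pose proof (Rabs_pos (s - t)); nra.
Qed.

Lemma Cexp_i_continuous (t : R) : Ccontinuous Cexp_i t.
Proof.
apply Ccontinuous_of_parts; [apply continuous_cos|apply continuous_sin].
Qed.

Lemma is_CInt_Ci_Cexp_i (a b : R) :
  is_CInt (fun t => Ci * Cexp_i t) a b (Cexp_i b - Cexp_i a).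
Proof.
split.
- apply (is_RInt_ext (V := R_NormedModule) (fun t => - sin t)%R).
  { intros t _; unfold Re, Ci, Cexp_i; simpl; ring. }
  apply (is_RInt_derive (V := R_CompleteNormedModule) cos (fun t => - sin t)%R).
  + intros t _; auto_derive; [exact I|ring].
  + intros t _; apply (continuous_opp (V := R_NormedModule)), continuous_sin.
- apply (is_RInt_ext (V := R_NormedModule) cos).
  { intros t _; unfold Im, Ci, Cexp_i; simpl; ring. }
  apply (is_RInt_derive (V := R_CompleteNormedModule) sin cos).
  + intros t _; auto_derive; [exact I|ring].
  + intros t _; apply continuous_cos.
Qed.

(* As sigma decreases from 0 to -oo these curves shrink the unit circle to w; the
   form dz / (z - w) pulls back to dsigma + angular_weight w t dt. *)
Definition circle_homotopy (w : C) (sigma t : R) : C :=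
  w + RtoC (exp sigma) * (Cexp_i t - w).

Definition angular_weight (w : C) (t : R) : C := Ci * Cexp_i t / (Cexp_i t - w).

Lemma Cexp_i_sub_ge (w : C) (t : R) : (1 - Cmod w <= Cmod (Cexp_i t - w))%R.
Proof. rewrite <- (Cexp_i_Cmod t); apply Cmod_sub_ge. Qed.

Lemma Cexp_i_sub_neq_0 (w : C) (t : R) : unit_disk w -> Cexp_i t - w <> 0.
Proof.
unfold unit_disk; intros Hw; apply Cmod_gt_0; pose proof (Cexp_i_sub_ge w t); lra.
Qed.

Lemma Cexp_i_sub_le (w : C) (t : R) : unit_disk w -> (Cmod (Cexp_i t - w) <= 2)%R.
Proof.
unfold unit_disk; intros Hw; unfold Cminus; eapply Rle_trans; [apply Cmod_triangle|].
rewrite Cmod_opp, Cexp_i_Cmod; lra.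
Qed.

Lemma angular_weight_continuous (w : C) (t : R) :
  unit_disk w -> Ccontinuous (angular_weight w) t.
Proof.
intros Hw; unfold angular_weight, Cdiv; apply Ccontinuous_mult.
- apply Ccontinuous_mult; [apply Ccontinuous_const|apply Cexp_i_continuous].
- apply (Ccontinuous_comp Cinv); [now apply Cdifferentiable_inv, Cexp_i_sub_neq_0|].
  apply Ccontinuous_plus; [apply Cexp_i_continuous|apply Ccontinuous_const].
Qed.

Lemma angular_weight_le (w : C) (t : R) :
  unit_disk w -> (Cmod (angular_weight w t) <= / (1 - Cmod w))%R.
Proof.
intros Hw; unfold angular_weight.
rewrite Cmod_div, Cmod_mult, Cmod_Ci, Cexp_i_Cmod by now apply Cexp_i_sub_neq_0.
unfold unit_disk in Hw; pose proof (Cexp_i_sub_ge w t).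
unfold Rdiv; rewrite !Rmult_1_l; apply Rinv_le_contravar; lra.
Qed.

Lemma circle_homotopy_Cmod (w : C) (sigma t : R) :
  unit_disk w -> (sigma <= 0)%R -> (Cmod (circle_homotopy w sigma t) <= 1)%R.
Proof.
unfold unit_disk; intros Hw Hs; unfold circle_homotopy.
set (e := exp sigma).
assert (He : (0 < e <= 1)%R) by (split; [apply exp_pos|now apply exp_le_1]).
replace (w + RtoC e * (Cexp_i t - w)) with (RtoC (1 - e) * w + RtoC e * Cexp_i t)
  by (rewrite RtoC_minus; ring).
eapply Rle_trans; [apply Cmod_triangle|].
rewrite !Cmod_mult, !Cmod_R, Cexp_i_Cmod, !Rabs_pos_eq by lra.
pose proof (Cmod_ge_0 w); nra.
Qed.

Lemma circle_homotopy_Lipschitz (w : C) (sigma tau s t : R) :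
  unit_disk w -> (sigma <= 0)%R -> (tau <= 0)%R ->
  (Cmod (circle_homotopy w sigma s - circle_homotopy w tau t)
   <= 2 * Rabs (sigma - tau) + 2 * Rabs (s - t))%R.
Proof.
intros Hw Hs Ht; unfold circle_homotopy.
replace (w + RtoC (exp sigma) * (Cexp_i s - w) - (w + RtoC (exp tau) * (Cexp_i t - w)))
  with (RtoC (exp sigma - exp tau) * (Cexp_i s - w) + RtoC (exp tau) * (Cexp_i s - Cexp_i t))
  by (rewrite RtoC_minus; ring).
eapply Rle_trans; [apply Cmod_triangle|].
rewrite !Cmod_mult, !Cmod_R, (Rabs_pos_eq (exp tau)) by (left; apply exp_pos).
pose proof (exp_le_1 tau Ht).
pose proof (exp_pos tau); pose proof (exp_Lipschitz sigma tau Hs Ht).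
pose proof (Cexp_i_sub_le w s Hw); pose proof (Cexp_i_Lipschitz s t).
pose proof (Cmod_ge_0 (Cexp_i s - w)); pose proof (Cmod_ge_0 (Cexp_i s - Cexp_i t)).
pose proof (Rabs_pos (exp sigma - exp tau)); pose proof (Rabs_pos (s - t)).
apply Rplus_le_compat; nra.
Qed.

Lemma circle_homotopy_continuous_l (w : C) (sigma t : R) :
  Ccontinuous (fun x => circle_homotopy w x t) sigma.
Proof.
apply Ccontinuous_plus; [apply Ccontinuous_const|].
apply Ccontinuous_mult; [|apply Ccontinuous_const].
apply Ccontinuous_of_parts; [apply continuous_exp|apply continuous_const].
Qed.

Lemma circle_homotopy_continuous_r (w : C) (sigma t : R) :
  Ccontinuous (circle_homotopy w sigma) t.
Proof.
apply Ccontinuous_plus; [apply Ccontinuous_const|].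
apply Ccontinuous_mult; [apply Ccontinuous_const|].
apply Ccontinuous_plus; [apply Cexp_i_continuous|apply Ccontinuous_const].
Qed.

Definition differentiable_on_closed_disk (F : C -> C) : Prop :=
  forall z, (Cmod z <= 1)%R -> Cdifferentiable F z.

Lemma circle_homotopy_comp_continuous_l (F : C -> C) (w : C) (sigma t : R) :
  differentiable_on_closed_disk F -> unit_disk w -> (sigma <= 0)%R ->
  Ccontinuous (fun x => F (circle_homotopy w x t)) sigma.
Proof.
intros HF Hw Hs.
apply (Ccontinuous_comp F (fun x => circle_homotopy w x t)).
- now apply HF, circle_homotopy_Cmod.
- apply circle_homotopy_continuous_l.
Qed.

Lemma circle_homotopy_comp_continuous_r (F : C -> C) (w : C) (sigma t : R) :
  differentiable_on_closed_disk F -> unit_disk w -> (sigma <= 0)%R ->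
  Ccontinuous (fun x => F (circle_homotopy w sigma x) * angular_weight w x) t.
Proof.
intros HF Hw Hs; apply Ccontinuous_mult; [|now apply angular_weight_continuous].
apply (Ccontinuous_comp F (circle_homotopy w sigma)).
- now apply HF, circle_homotopy_Cmod.
- apply circle_homotopy_continuous_r.
Qed.

Definition radial_integral (F : C -> C) (w : C) (a t s : R) : C :=
  CInt (fun x => F (circle_homotopy w x t)) a (a + s)%R.

Definition angular_integral (F : C -> C) (w : C) (sigma b s : R) : C :=
  CInt (fun t => F (circle_homotopy w sigma t) * angular_weight w t) b (b + s)%R.

Definition boundary_integral (F : C -> C) (w : C) (a b s : R) : C :=
  radial_integral F w a b s + angular_integral F w (a + s) b s
  - radial_integral F w a (b + s) s - angular_integral F w a b s.

Lemma radial_integral_correct (F : C -> C) (w : C) (a t s : R) :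
  differentiable_on_closed_disk F -> unit_disk w -> (0 <= s)%R -> (a + s <= 0)%R ->
  is_CInt (fun x => F (circle_homotopy w x t)) a (a + s) (radial_integral F w a t s).
Proof.
intros HF Hw Hs Ha; apply CInt_correct; [lra|]; intros x Hx.
apply circle_homotopy_comp_continuous_l; auto; lra.
Qed.

Lemma angular_integral_correct (F : C -> C) (w : C) (sigma b s : R) :
  differentiable_on_closed_disk F -> unit_disk w -> (0 <= s)%R -> (sigma <= 0)%R ->
  is_CInt (fun t => F (circle_homotopy w sigma t) * angular_weight w t) b (b + s)
    (angular_integral F w sigma b s).
Proof.
intros HF Hw Hs Ha; apply CInt_correct; [lra|]; intros x Hx.
apply circle_homotopy_comp_continuous_r; auto; lra.
Qed.

Lemma boundary_integral_add (F : C -> C) (w : C) (a b s : R) :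
  differentiable_on_closed_disk F -> unit_disk w -> (0 < s)%R -> (a + (s + s) <= 0)%R ->
  boundary_integral F w a b (s + s)
  = boundary_integral F w a b s + boundary_integral F w (a + s) b s
    + boundary_integral F w a (b + s) s + boundary_integral F w (a + s) (b + s) s.
Proof.
intros HF Hw Hs Ha.
assert (HR : forall t, radial_integral F w a t (s + s)
  = radial_integral F w a t s + radial_integral F w (a + s) t s).
{ intros t; eapply is_CInt_unique; [apply radial_integral_correct; auto; lra|].
  eapply is_CInt_Chasles; [apply radial_integral_correct; auto; lra|].
  rewrite <- Rplus_assoc; apply radial_integral_correct; auto; lra. }
assert (HA : forall sigma, (sigma <= 0)%R -> angular_integral F w sigma b (s + s)
  = angular_integral F w sigma b s + angular_integral F w sigma (b + s) s).
{ intros sigma H; eapply is_CInt_unique; [apply angular_integral_correct; auto; lra|].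
  eapply is_CInt_Chasles; [apply angular_integral_correct; auto; lra|].
  rewrite <- Rplus_assoc; apply angular_integral_correct; auto; lra. }
unfold boundary_integral; rewrite !HR, !HA by lra.
rewrite <- !(Rplus_assoc a), <- !(Rplus_assoc b); ring.
Qed.

(* The model integral is that of A + B (z - w), whose boundary integral vanishes. *)
Lemma boundary_integral_le (F : C -> C) (w A B : C) (a b s e : R) :
  differentiable_on_closed_disk F -> unit_disk w -> (0 < s)%R -> (a + s <= 0)%R ->
  (forall x t, (a <= x <= a + s)%R -> (b <= t <= b + s)%R ->
     (Cmod (F (circle_homotopy w x t) - (A + B * (circle_homotopy w x t - w))) <= e)%R) ->
  (Cmod (boundary_integral F w a b s) <= 8 * (e / (1 - Cmod w)) * s)%R.
Proof.
intros HF Hw Hs Ha He.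
assert (Hw1 : (1 <= / (1 - Cmod w))%R).
{ unfold unit_disk in Hw; rewrite <- Rinv_1; apply Rinv_le_contravar; [lra|].
  pose proof (Cmod_ge_0 w); lra. }
assert (He0 : (0 <= e)%R).
{ eapply Rle_trans; [apply Cmod_ge_0|apply (He a b); lra]. }
assert (Hee : (e <= e / (1 - Cmod w))%R) by (unfold Rdiv; nra).
set (K := CInt (angular_weight w) b (b + s)%R).
assert (HK : is_CInt (angular_weight w) b (b + s) K)
  by (apply CInt_correct; [lra|]; intros; now apply angular_weight_continuous).
set (mR := fun t => RtoC (a + s - a) * A
  + (RtoC (exp (a + s)) - RtoC (exp a)) * (B * (Cexp_i t - w))).
set (mA := fun x => A * K
  + (RtoC (exp x) * B) * (Cexp_i (b + s) - Cexp_i b)).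
assert (HR : forall t, (b <= t <= b + s)%R ->
  (Cmod (radial_integral F w a t s - mR t) <= 2 * (e / (1 - Cmod w)) * s)%R).
{ intros t Ht.
  assert (Hexp : is_CInt (fun x => RtoC (exp x)) a (a + s) (RtoC (exp (a + s)) - RtoC (exp a))).
  { split.
    - apply (is_RInt_derive (V := R_CompleteNormedModule) exp exp).
      + intros x _; auto_derive; [exact I|ring].
      + intros x _; apply continuous_exp.
    - replace (Im (RtoC (exp (a + s)) - RtoC (exp a))) with (scal (a + s - a)%R 0%R)
        by (change ((a + s - a) * 0 = 0 + - 0)%R; ring).
      apply (is_RInt_const (V := R_NormedModule)). }
  assert (HI : is_CInt (fun x => F (circle_homotopy w x t)
      - (A + (B * (Cexp_i t - w)) * RtoC (exp x))) a (a + s)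
    (radial_integral F w a t s
      - (RtoC (a + s - a) * A + (B * (Cexp_i t - w)) * (RtoC (exp (a + s)) - RtoC (exp a))))).
  { apply is_CInt_minus; [apply radial_integral_correct; auto; lra|].
    apply is_CInt_plus; [apply is_CInt_const|now apply is_CInt_scal]. }
  apply is_CInt_Cmod_le with (e := e) in HI; [|lra|].
  - unfold mR; rewrite (Cmult_comm (RtoC (exp (a + s)) - RtoC (exp a))).
    nra.
  - intros x Hx; specialize (He x t Hx Ht).
    replace (B * (Cexp_i t - w) * RtoC (exp x)) with (B * (circle_homotopy w x t - w))
      by (unfold circle_homotopy; ring).
    exact He. }
assert (HA : forall x, (a <= x <= a + s)%R ->
  (Cmod (angular_integral F w x b s - mA x) <= 2 * (e / (1 - Cmod w)) * s)%R).
{ intros x Hx.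
  assert (HI : is_CInt (fun t => F (circle_homotopy w x t) * angular_weight w t
      - (A * angular_weight w t + (RtoC (exp x) * B) * (Ci * Cexp_i t))) b (b + s)
    (angular_integral F w x b s - mA x)).
  { apply is_CInt_minus; [apply angular_integral_correct; auto; lra|].
    apply is_CInt_plus; apply is_CInt_scal; [exact HK|apply is_CInt_Ci_Cexp_i]. }
  apply is_CInt_Cmod_le with (e := (e / (1 - Cmod w))%R) in HI; [|lra|].
  - replace (b + s - b)%R with s in HI by ring; exact HI.
  - intros t Ht; specialize (He x t Hx Ht).
    replace (F (circle_homotopy w x t) * angular_weight w t
      - (A * angular_weight w t + RtoC (exp x) * B * (Ci * Cexp_i t)))
      with ((F (circle_homotopy w x t) - (A + B * (circle_homotopy w x t - w)))
        * angular_weight w t)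
      by (unfold circle_homotopy, angular_weight; field; now apply Cexp_i_sub_neq_0).
    rewrite Cmod_mult; apply Rmult_le_compat; auto using Cmod_ge_0, angular_weight_le. }
replace (boundary_integral F w a b s) with
  ((radial_integral F w a b s - mR b) + (angular_integral F w (a + s) b s - mA (a + s)%R)
   - (radial_integral F w a (b + s) s - mR (b + s)%R) - (angular_integral F w a b s - mA a))
  by (unfold boundary_integral, mR, mA; ring).
pose proof (HR b ltac:(lra)) as H1; pose proof (HR (b + s)%R ltac:(lra)) as H2.
pose proof (HA a ltac:(lra)) as H3; pose proof (HA (a + s)%R ltac:(lra)) as H4.
unfold Cminus at 1; eapply Rle_trans; [apply Cmod_triangle|rewrite Cmod_opp].
unfold Cminus at 1; eapply Rle_trans; [apply Rplus_le_compat_r, Cmod_triangle|rewrite Cmod_opp].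
pose proof (Cmod_triangle (radial_integral F w a b s - mR b)
  (angular_integral F w (a + s) b s - mA (a + s)%R)).
lra.
Qed.

Lemma boundary_integral_0 (F : C -> C) (w : C) (a b s : R) :
  differentiable_on_closed_disk F -> unit_disk w -> (0 < s)%R -> (a + s <= 0)%R ->
  boundary_integral F w a b s = 0.
Proof.
intros HF Hw Hs Ha; apply Goursat_bisection; [exact Hs| |].
- intros a' b' s' H1 H2 H3 H4 H5; apply boundary_integral_add; auto; lra.
- intros x y eps Hx Hy Heps.
  set (p := circle_homotopy w x y).
  destruct (proj1 (Cdifferentiable_eps F p)) as [l Hl]; [apply HF, circle_homotopy_Cmod; auto; lra|].
  assert (Hw' := Hw); unfold unit_disk in Hw'.
  destruct (Hl (eps * (1 - Cmod w) / 32)%R) as [d [Hd0 Hd]].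
  { apply Rdiv_lt_0_compat; [apply Rmult_lt_0_compat|]; lra. }
  exists (d / 4)%R; split; [lra|]; intros a' b' s' Hs' A1 A2 A3 B1 B2 B3.
  replace (eps * (s' * s'))%R
    with (8 * ((eps * (1 - Cmod w) / 32 * (4 * s')) / (1 - Cmod w)) * s')%R by (field; lra).
  apply boundary_integral_le with (A := F p - l * (p - w)) (B := l); auto; try lra.
  intros x' t' Hx' Ht'; set (u := circle_homotopy w x' t').
  replace (F u - (F p - l * (p - w) + l * (u - w))) with (F u - F p - l * (u - p)) by ring.
  assert (Hup : (Cmod (u - p) <= 4 * s')%R).
  { eapply Rle_trans; [apply circle_homotopy_Lipschitz; auto; lra|].
    assert (Rabs (x' - x) <= s')%R by (apply Rabs_le; lra).
    assert (Rabs (t' - y) <= s')%R by (apply Rabs_le; lra).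
    lra. }
  eapply Rle_trans; [apply Hd; lra|].
  apply Rmult_le_compat_l; [|exact Hup].
  left; apply Rdiv_lt_0_compat; [apply Rmult_lt_0_compat|]; lra.
Qed.

Lemma angular_integral_shift (F : C -> C) (w : C) (a : R) :
  differentiable_on_closed_disk F -> unit_disk w -> (a + 2 * PI <= 0)%R ->
  angular_integral F w (a + 2 * PI) 0 (2 * PI) = angular_integral F w a 0 (2 * PI).
Proof.
intros HF Hw Ha.
assert (HPI := PI_RGT_0).
assert (H := boundary_integral_0 F w a 0 (2 * PI) HF Hw ltac:(lra) Ha).
assert (E : radial_integral F w a (0 + 2 * PI) (2 * PI) = radial_integral F w a 0 (2 * PI)).
{ unfold radial_integral, circle_homotopy, Cexp_i.
  now rewrite Rplus_0_l, cos_2PI, sin_2PI, cos_0, sin_0. }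
unfold boundary_integral in H; rewrite E in H.
set (x := angular_integral F w (a + 2 * PI) 0 (2 * PI)) in *.
set (y := angular_integral F w a 0 (2 * PI)) in *.
replace x with (radial_integral F w a 0 (2 * PI) + x - radial_integral F w a 0 (2 * PI) - y + y)
  by ring.
rewrite H; ring.
Qed.

Lemma angular_integral_constant (F : C -> C) (w : C) (m : nat) :
  differentiable_on_closed_disk F -> unit_disk w ->
  angular_integral F w (- INR m * (2 * PI)) 0 (2 * PI) = angular_integral F w 0 0 (2 * PI).
Proof.
intros HF Hw; assert (HPI := PI_RGT_0); induction m as [|m IH].
- f_equal; simpl; ring.
- rewrite <- IH, <- angular_integral_shift; auto.
  + f_equal; rewrite S_INR; ring.
  + rewrite S_INR; pose proof (pos_INR m); nra.
Qed.

Definition total_weight (w : C) : C := CInt (angular_weight w) 0 (2 * PI).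

Lemma total_weight_correct (w : C) :
  unit_disk w -> is_CInt (angular_weight w) 0 (2 * PI) (total_weight w).
Proof.
intros Hw; apply CInt_correct; [pose proof PI_RGT_0; lra|].
intros; now apply angular_weight_continuous.
Qed.

Lemma differentiable_continuous (F : C -> C) (z : C) (eps : R) :
  Cdifferentiable F z -> (0 < eps)%R ->
  exists delta, (0 < delta)%R /\
    forall u, (Cmod (u - z) < delta)%R -> (Cmod (F u - F z) <= eps)%R.
Proof.
intros HF He; apply Cdifferentiable_eps in HF as [l Hl].
destruct (Hl 1%R Rlt_0_1) as [d [Hd0 Hd]].
assert (Hl1 : (0 < Cmod l + 1)%R) by (pose proof (Cmod_ge_0 l); lra).
exists (Rmin d (eps / (Cmod l + 1))); split.
{ apply Rmin_pos; [lra|now apply Rdiv_lt_0_compat]. }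
intros u Hu.
specialize (Hd u (Rlt_le_trans _ _ _ Hu (Rmin_l _ _))).
assert (Hu2 := Rlt_le_trans _ _ _ Hu (Rmin_r _ _)).
apply Rlt_div_r in Hu2; [|lra].
replace (F u - F z) with ((F u - F z - l * (u - z)) + l * (u - z)) by ring.
eapply Rle_trans; [apply Cmod_triangle|]; rewrite Cmod_mult; nra.
Qed.

Lemma angular_integral_eq (F : C -> C) (w : C) :
  differentiable_on_closed_disk F -> unit_disk w ->
  angular_integral F w 0 0 (2 * PI) = F w * total_weight w.
Proof.
intros HF Hw; assert (HPI := PI_RGT_0); assert (Hw' := Hw); unfold unit_disk in Hw'.
set (x := angular_integral F w 0 0 (2 * PI)).
assert (Hx : forall eps, (0 < eps)%R ->
  (Cmod (x - F w * total_weight w) <= 2 * (eps * / (1 - Cmod w)) * (2 * PI))%R).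
{ intros eps Heps.
  destruct (differentiable_continuous F w eps) as [d [Hd0 Hd]]; [apply HF; lra|exact Heps|].
  destruct (nfloor_ex (2 / d)) as [m [_ Hm]]; [left; now apply Rdiv_lt_0_compat; lra|].
  set (sigma := (- INR (S m) * (2 * PI))%R).
  assert (Hs : (sigma <= 0)%R)
    by (unfold sigma; pose proof (pos_INR (S m)); nra).
  assert (Hexp : (2 * exp sigma < d)%R).
  { assert (H1 : (2 / d < exp (- sigma))%R).
    { eapply Rlt_le_trans; [exact Hm|].
      eapply Rle_trans; [|apply exp_ineq1_le].
      unfold sigma; rewrite S_INR; pose proof (pos_INR m); pose proof PI2_3_2; nra. }
    rewrite exp_Ropp in H1; pose proof (exp_pos sigma) as H2.
    apply Rlt_div_l in H1; [|lra].
    apply (Rmult_lt_compat_l (exp sigma)) in H1; [|lra].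
    replace (exp sigma * (/ exp sigma * d))%R with d in H1 by (field; lra); lra. }
  assert (HI : is_CInt (fun t => F (circle_homotopy w sigma t) * angular_weight w t
      - F w * angular_weight w t) 0 (0 + 2 * PI)
    (angular_integral F w sigma 0 (2 * PI) - F w * total_weight w)).
  { apply is_CInt_minus; [apply angular_integral_correct; auto; lra|].
    rewrite Rplus_0_l; now apply is_CInt_scal, total_weight_correct. }
  unfold sigma in HI at 2; rewrite angular_integral_constant in HI by assumption; fold x in HI.
  apply is_CInt_Cmod_le with (e := (eps * / (1 - Cmod w))%R) in HI; [|lra|].
  - now replace (0 + 2 * PI - 0)%R with (2 * PI)%R in HI by ring.
  - intros t _.
    replace (F (circle_homotopy w sigma t) * angular_weight w t - F w * angular_weight w t)
      with ((F (circle_homotopy w sigma t) - F w) * angular_weight w t) by ring.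
    rewrite Cmod_mult; apply Rmult_le_compat; auto using Cmod_ge_0, angular_weight_le.
    apply Hd; unfold circle_homotopy.
    replace (w + RtoC (exp sigma) * (Cexp_i t - w) - w)
      with (RtoC (exp sigma) * (Cexp_i t - w)) by ring.
    rewrite Cmod_mult, Cmod_R, Rabs_pos_eq by (left; apply exp_pos).
    pose proof (exp_pos sigma); pose proof (Cexp_i_sub_le w t Hw); nra. }
assert (H0 : Cmod (x - F w * total_weight w) = 0%R).
{ apply Rle_antisym; [|apply Cmod_ge_0].
  apply le_epsilon; intros eps Heps; rewrite Rplus_0_l.
  specialize (Hx (eps * (1 - Cmod w) / (4 * PI))%R).
  replace (2 * (eps * (1 - Cmod w) / (4 * PI) * / (1 - Cmod w)) * (2 * PI))%R with eps in Hx
    by (field; lra).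
  apply Hx, Rdiv_lt_0_compat; [apply Rmult_lt_0_compat|]; lra. }
apply Cmod_eq_0 in H0.
replace x with (x - F w * total_weight w + F w * total_weight w) by ring.
rewrite H0; ring.
Qed.

Lemma circle_homotopy_0 (w : C) (t : R) : circle_homotopy w 0 t = Cexp_i t.
Proof. unfold circle_homotopy; rewrite exp_0; ring. Qed.

Lemma Cauchy_angular (F : C -> C) (w : C) :
  differentiable_on_closed_disk F -> unit_disk w ->
  is_CInt (fun t => F (Cexp_i t) * angular_weight w t) 0 (2 * PI) (F w * total_weight w).
Proof.
intros HF Hw; assert (HPI := PI_RGT_0).
rewrite <- angular_integral_eq by assumption.
replace (2 * PI)%R with (0 + 2 * PI)%R at 1 by ring.
eapply is_CInt_ext; [|apply angular_integral_correct; auto; lra].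
intros t _; cbv beta; now rewrite circle_homotopy_0.
Qed.

Lemma total_weight_0 : total_weight 0 = RtoC (2 * PI) * Ci.
Proof.
assert (H0 : unit_disk 0) by (unfold unit_disk; rewrite Cmod_0; lra).
eapply is_CInt_unique; [now apply total_weight_correct|].
replace (2 * PI)%R with (2 * PI - 0)%R at 2 by ring.
eapply is_CInt_ext; [|apply is_CInt_const].
intros t _; unfold angular_weight; field.
pose proof (Cexp_i_sub_neq_0 0 t H0) as H; intros E; apply H; rewrite E; ring.
Qed.

Lemma Cconj_RtoC (x : R) : Cconj (RtoC x) = RtoC x.
Proof. unfold Cconj, RtoC; simpl; now rewrite Ropp_0. Qed.

Lemma szego_conj_circle (w : C) (t : R) :
  unit_disk w -> Cconj (szego (Cexp_i t) w) = Cexp_i t / (Cexp_i t - w).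
Proof.
intros Hw; unfold szego.
assert (H1 : 1 - Cexp_i t * Cconj w <> 0).
{ apply one_sub_neq_0; rewrite Cmod_mult, Cmod_conj, Cexp_i_Cmod, Rmult_1_l; exact Hw. }
assert (H2 := Cexp_i_sub_neq_0 w t Hw).
assert (E := Cexp_i_conj t).
rewrite Cinv_conj, Cminus_conj, Cmult_conj, Cconj_conj by exact H1.
rewrite Cconj_RtoC.
assert (H3 : Cexp_i t <> 0) by (apply Cmod_gt_0; rewrite Cexp_i_Cmod; lra).
assert (E' : Cconj (Cexp_i t) = / Cexp_i t).
{ replace (Cconj (Cexp_i t)) with (/ Cexp_i t * (Cexp_i t * Cconj (Cexp_i t))) by (field; auto).
  rewrite E; ring. }
rewrite E'; field; split; auto.
Qed.

Lemma Ci_mul : Ci * Ci = - (1).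
Proof. unfold Ci, Cmult, Copp, RtoC; simpl; f_equal; ring. Qed.

Lemma total_weight_eq (w : C) : unit_disk w -> total_weight w = RtoC (2 * PI) * Ci.
Proof.
intros Hw; assert (H0 : unit_disk 0) by (unfold unit_disk; rewrite Cmod_0; lra).
assert (H := Cauchy_angular (fun z => szego z w) 0
  (fun z Hz => szego_differentiable w z Hw Hz) H0).
rewrite total_weight_0 in H.
apply (is_CInt_scal (- Ci)) in H; apply is_CInt_conj in H; apply (is_CInt_scal Ci) in H.
eapply is_CInt_unique; [now apply total_weight_correct|].
replace (RtoC (2 * PI) * Ci) with
  (Ci * Cconj (- Ci * (szego 0 w * (RtoC (2 * PI) * Ci)))).
- eapply is_CInt_ext; [|exact H]; intros t _; cbv beta.
  replace (- Ci * (szego (Cexp_i t) w * angular_weight 0 t)) with (szego (Cexp_i t) w).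
  + rewrite szego_conj_circle by exact Hw; unfold angular_weight.
    unfold Cdiv; ring.
  + replace (angular_weight 0 t) with Ci.
    * replace (- Ci * (szego (Cexp_i t) w * Ci)) with (szego (Cexp_i t) w * - (Ci * Ci)) by ring.
      rewrite Ci_mul; ring.
    * unfold angular_weight; field.
      pose proof (Cexp_i_sub_neq_0 0 t H0) as K; intros E; apply K; rewrite E; ring.
- unfold szego; replace (1 - 0 * Cconj w) with (RtoC 1) by ring.
  unfold Ci, Cmult, Copp, Cconj, Cinv, RtoC; simpl; f_equal; field.
Qed.

Lemma Szego_reproducing (F : C -> C) (w : C) :
  differentiable_on_closed_disk F -> unit_disk w ->
  is_CInt (fun t => F (Cexp_i t) * Cconj (szego (Cexp_i t) w)) 0 (2 * PI)
    (RtoC (2 * PI) * F w).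
Proof.
intros HF Hw; assert (H := Cauchy_angular F w HF Hw).
rewrite total_weight_eq in H by exact Hw.
apply (is_CInt_scal (- Ci)) in H.
assert (HC : - (Ci * Ci) = 1) by (rewrite Ci_mul; ring).
replace (RtoC (2 * PI) * F w) with (- Ci * (F w * (RtoC (2 * PI) * Ci))).
- eapply is_CInt_ext; [|exact H]; intros t _; cbv beta.
  rewrite szego_conj_circle by exact Hw; unfold angular_weight, Cdiv.
  transitivity (- (Ci * Ci) * (F (Cexp_i t) * (Cexp_i t * / (Cexp_i t - w)))); [ring|].
  rewrite HC; ring.
- transitivity (- (Ci * Ci) * (RtoC (2 * PI) * F w)); [ring|rewrite HC; ring].
Qed.

(** * Positivity of the Pick kernel *)

Lemma Csum_ext (u v : nat -> C) (n : nat) :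
  (forall i, (i <= n)%nat -> u i = v i) -> sum_n u n = sum_n v n.
Proof. apply sum_n_ext_loc. Qed.

Lemma Csum_mult_l (a : C) (u : nat -> C) (n : nat) :
  sum_n (fun i => a * u i) n = a * sum_n u n :> C.
Proof. exact (sum_n_mult_l (K := C_Ring) a u n). Qed.

Lemma Csum_mult_r (a : C) (u : nat -> C) (n : nat) :
  sum_n (fun i => u i * a) n = sum_n u n * a :> C.
Proof. exact (sum_n_mult_r (K := C_Ring) a u n). Qed.

Lemma Csum_plus (u v : nat -> C) (n : nat) :
  sum_n (fun i => u i + v i) n = sum_n u n + sum_n v n :> C.
Proof. exact (sum_n_plus (G := C_AbelianMonoid) u v n). Qed.

Lemma Csum_minus (u v : nat -> C) (n : nat) :
  sum_n (fun i => u i - v i) n = sum_n u n - sum_n v n :> C.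
Proof.
transitivity (sum_n u n + (- (1)) * sum_n v n); [|ring].
rewrite <- Csum_mult_l, <- Csum_plus; apply Csum_ext; intros; ring.
Qed.

Lemma Csum_conj (u : nat -> C) (n : nat) :
  Cconj (sum_n u n) = sum_n (fun i => Cconj (u i)) n :> C.
Proof.
induction n as [|n IH]; [now rewrite !sum_O|].
rewrite !sum_Sn, <- IH; apply Cplus_conj.
Qed.

Definition szego_comb (z c : nat -> C) (n : nat) (u : C) : C :=
  sum_n (fun j => c j * szego u (z j)) n.

Definition szego_gram (z c : nat -> C) (n : nat) : C :=
  sum_n (fun i => Cconj (c i) * szego_comb z c n (z i)) n.

Lemma szego_comb_differentiable (z c : nat -> C) (n : nat) :
  (forall i, (i <= n)%nat -> unit_disk (z i)) ->
  differentiable_on_closed_disk (szego_comb z c n).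
Proof.
intros Hz u Hu; apply (Cdifferentiable_sum_n (fun j u => c j * szego u (z j))); intros i Hi.
apply (Cdifferentiable_mult (fun _ => c i)); [apply Cdifferentiable_const|].
apply szego_differentiable; auto.
Qed.

Lemma szego_comb_reproducing (F : C -> C) (z c : nat -> C) (n : nat) :
  differentiable_on_closed_disk F ->
  (forall i, (i <= n)%nat -> unit_disk (z i)) ->
  is_CInt (fun t => F (Cexp_i t) * Cconj (szego_comb z c n (Cexp_i t))) 0 (2 * PI)
    (RtoC (2 * PI) * sum_n (fun i => Cconj (c i) * F (z i)) n).
Proof.
intros HF Hz; rewrite <- Csum_mult_l.
eapply is_CInt_ext; [|apply is_CInt_sum_n].
- intros t _; unfold szego_comb; rewrite Csum_conj, <- Csum_mult_l.
  apply Csum_ext; intros i _; symmetry.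
  rewrite Cmult_conj.
  transitivity (Cconj (c i) * (F (Cexp_i t) * Cconj (szego (Cexp_i t) (z i)))); [ring|].
  reflexivity.
- intros i Hi; cbv beta.
  replace (RtoC (2 * PI) * (Cconj (c i) * F (z i)))
    with (Cconj (c i) * (RtoC (2 * PI) * F (z i))) by ring.
  apply is_CInt_scal, Szego_reproducing; auto.
Qed.

Lemma szego_gram_integral (z c : nat -> C) (n : nat) :
  (forall i, (i <= n)%nat -> unit_disk (z i)) ->
  is_CInt (fun t => RtoC (Cmod (szego_comb z c n (Cexp_i t)) ^ 2)) 0 (2 * PI)
    (RtoC (2 * PI) * szego_gram z c n).
Proof.
intros Hz; eapply is_CInt_ext;
  [|apply (szego_comb_reproducing (szego_comb z c n) z c n); auto].
- intros t _; cbv beta; now rewrite <- Cmod2_conj.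
- now apply szego_comb_differentiable.
Qed.

Lemma Cnonneg_scal_inv (a : R) (x : C) : (0 < a)%R -> Cnonneg (RtoC a * x) -> Cnonneg x.
Proof.
intros Ha [H1 H2]; unfold Cnonneg, Re, Im in *; simpl in *; split; nra.
Qed.

Lemma szego_gram_nonneg (z c : nat -> C) (n : nat) :
  (forall i, (i <= n)%nat -> unit_disk (z i)) -> Cnonneg (szego_gram z c n).
Proof.
intros Hz; assert (HPI := PI_RGT_0).
apply Cnonneg_scal_inv with (2 * PI)%R; [lra|].
assert (H := szego_gram_integral z c n Hz); split.
- eapply is_CInt_Im_0; [|exact H]; intros t; reflexivity.
- eapply is_CInt_Re_ge_0; [|intros t|exact H]; [lra|].
  apply pow2_ge_0.
Qed.

Lemma szego_gram_le (z c : nat -> C) (n : nat) (K : R) :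
  (forall i, (i <= n)%nat -> unit_disk (z i)) ->
  (forall t, (Cmod (szego_comb z c n (Cexp_i t)) <= K)%R) ->
  (Re (szego_gram z c n) <= 2 * K ^ 2)%R.
Proof.
intros Hz HK; assert (HPI := PI_RGT_0).
assert (H := szego_gram_integral z c n Hz).
apply is_CInt_Cmod_le with (e := (K ^ 2)%R) in H; [|lra|].
- rewrite Cmod_mult, Cmod_R, Rabs_pos_eq in H by lra.
  assert (H1 := re_le_Cmod (szego_gram z c n)).
  pose proof (Rle_abs (Re (szego_gram z c n))).
  nra.
- intros t _; rewrite Cmod_R, Rabs_pos_eq by apply pow2_ge_0.
  apply pow_incr; split; [apply Cmod_ge_0|apply HK].
Qed.

(* Expands the integral of |M phi - h psi / M|^2 bounded below by 0, where phi and psi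
   are the kernel combinations with coefficients c and c * conj h(z). *)
Lemma Pick_nonneg (h : C -> C) (M : R) (z c : nat -> C) (n : nat) :
  differentiable_on_closed_disk h ->
  (0 < M)%R ->
  (forall u, (Cmod u <= 1)%R -> (Cmod (h u) <= M)%R) ->
  (forall i, (i <= n)%nat -> unit_disk (z i)) ->
  Cnonneg (RtoC (M ^ 2) * szego_gram z c n
           - szego_gram z (fun j => c j * Cconj (h (z j))) n).
Proof.
intros Hh HM0 HM Hz; assert (HPI := PI_RGT_0).
set (d := fun j => c j * Cconj (h (z j))).
set (phi := szego_comb z c n); set (psi := szego_comb z d n).
assert (Hphi := szego_gram_nonneg z c n Hz).
assert (Hpsi := szego_gram_nonneg z d n Hz).
split.
{ destruct Hphi as [H1 _], Hpsi as [H2 _].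
  unfold Cnonneg, Re, Im in *; simpl in *; nra. }
assert (I1 := szego_gram_integral z c n Hz).
assert (I2 := szego_gram_integral z d n Hz).
assert (I3 := szego_comb_reproducing (fun u => h u * psi u) z c n
  (fun u Hu => Cdifferentiable_mult h psi u (Hh u Hu) (szego_comb_differentiable z d n Hz u Hu)) Hz).
assert (E : sum_n (fun i => Cconj (c i) * (h (z i) * psi (z i))) n = szego_gram z d n :> C).
{ unfold szego_gram; apply Csum_ext; intros i _; unfold d at 1.
  rewrite Cmult_conj, Cconj_conj; unfold psi; ring. }
cbv beta in I3; rewrite E in I3.
apply (is_CInt_scal (RtoC (M ^ 2))) in I1.
apply (is_CInt_scal (1 + 1)) in I3.
assert (I := is_CInt_plus _ _ _ _ _ _ (is_CInt_minus _ _ _ _ _ _ I1 I3) I2).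
apply is_CInt_Re_ge_0 in I; [|lra|].
- apply (Rmult_le_reg_l (2 * PI)); [lra|].
  set (x := RtoC (M ^ 2) * szego_gram z c n - szego_gram z d n).
  replace (2 * PI * Re x)%R with (Re (RtoC (2 * PI) * x))
    by (change (2 * PI * Re x - 0 * Im x = 2 * PI * Re x)%R; ring).
  rewrite Rmult_0_r; eapply Rle_trans; [exact I|].
  right; f_equal; unfold x; ring.
- intros t; cbv beta; fold phi; fold psi.
  set (p := phi (Cexp_i t)); set (q := psi (Cexp_i t)); set (e := h (Cexp_i t)).
  assert (He : (Cmod e <= M)%R) by (apply HM; rewrite Cexp_i_Cmod; lra).
  assert (Hr : (Re (e * q * Cconj p) <= M * Cmod q * Cmod p)%R).
  { eapply Rle_trans; [apply Rle_abs|eapply Rle_trans; [apply re_le_Cmod|]].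
    rewrite !Cmod_mult, Cmod_conj.
    apply Rmult_le_compat_r; [apply Cmod_ge_0|].
    apply Rmult_le_compat_r; [apply Cmod_ge_0|exact He]. }
  change (0 <= (M ^ 2 * (Cmod p ^ 2) - 0 * 0
    + - ((1 + 1) * Re (e * q * Cconj p) - (0 + 0) * Im (e * q * Cconj p))) + Cmod q ^ 2)%R.
  assert (0 <= (M * Cmod p - Cmod q) ^ 2)%R by apply pow2_ge_0.
  nra.
Qed.

Lemma Delta_sum (M : R) (g f : C -> C) (z c : nat -> C) (n : nat) :
  sum_n (fun i => sum_n (fun j => Delta_kernel M g f (z i) (z j) * c j * Cconj (c i)) n) n
  = RtoC (M ^ 2 * alpha_sq f) * szego_gram z c n
    - szego_gram (fun i => f (z i)) (fun j => c j * Cconj (g (z j))) n :> C.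
Proof.
unfold szego_gram, szego_comb.
rewrite <- Csum_mult_l, <- Csum_minus; apply Csum_ext; intros i _.
rewrite <- !Csum_mult_l, <- Csum_minus; apply Csum_ext; intros j _.
unfold Delta_kernel; rewrite Cmult_conj, Cconj_conj; ring.
Qed.

Lemma szego_gram_ge (w d : nat -> C) (n : nat) :
  (forall i, (i <= n)%nat -> unit_disk (w i)) ->
  (Cmod (sum_n (fun i => Cconj (d i)) n) ^ 2 <= Re (szego_gram w d n))%R.
Proof.
intros Hw.
assert (H := szego_gram_nonneg w (fun j => d j * Cconj (w j)) n Hw).
assert (E : szego_gram w d n = RtoC (Cmod (sum_n (fun i => Cconj (d i)) n) ^ 2)
  + szego_gram w (fun j => d j * Cconj (w j)) n).
{ rewrite Cmod2_conj, Csum_conj, <- Csum_mult_r.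
  unfold szego_gram, szego_comb; rewrite <- Csum_plus; apply Csum_ext; intros i Hi.
  rewrite <- !Csum_mult_l, <- Csum_plus; apply Csum_ext; intros j Hj.
  rewrite Cmult_conj, !Cconj_conj; unfold szego; field.
  apply one_sub_neq_0; rewrite Cmod_mult, Cmod_conj.
  pose proof (Hw i Hi); pose proof (Hw j Hj); unfold unit_disk in *.
  pose proof (Cmod_ge_0 (w i)); pose proof (Cmod_ge_0 (w j)); nra. }
rewrite E, re_plus; destruct H as [_ H].
unfold Re at 2; simpl; simpl in *; lra.
Qed.

Lemma Ccontinuous_conj (f : R -> C) (t : R) :
  Ccontinuous f t -> Ccontinuous (fun s => Cconj (f s)) t.
Proof.
intros H; apply Ccontinuous_of_parts; [exact (Ccontinuous_Re f t H)|].
apply (continuous_opp (V := R_NormedModule) (fun s => Im (f s))); now apply Ccontinuous_Im.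
Qed.

Lemma Ccontinuous_sum_n (f : nat -> R -> C) (n : nat) (t : R) :
  (forall i, (i <= n)%nat -> Ccontinuous (f i) t) ->
  Ccontinuous (fun s => sum_n (fun i => f i s) n) t.
Proof.
induction n as [|n IH]; intros H.
- apply (continuous_ext (T := R_UniformSpace) (U := AbsRing_UniformSpace C_AbsRing) (f 0%nat)).
  + intros s; exact (eq_sym (sum_O (G := C_AbelianMonoid) (fun i => f i s))).
  + now apply H.
- apply (continuous_ext (T := R_UniformSpace) (U := AbsRing_UniformSpace C_AbsRing)
    (fun s => sum_n (fun i => f i s) n + f (S n) s)).
  + intros s; exact (eq_sym (sum_Sn (G := C_AbelianMonoid) (fun i => f i s) n)).
  + apply Ccontinuous_plus; [apply IH; intros i Hi|]; apply H; lia.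
Qed.

Lemma Cnonneg_left_limit (f : R -> C) :
  Ccontinuous f 1 -> (forall r, (0 < r < 1)%R -> Cnonneg (f r)) -> Cnonneg (f 1%R).
Proof.
intros Hf H.
assert (Happrox : forall eps, (0 < eps)%R -> exists r,
  Cnonneg (f r) /\ (Cmod (f r - f 1%R) < eps)%R).
{ intros eps Heps; destruct (proj1 (Ccontinuous_eps f 1) Hf eps Heps) as [d [Hd0 Hd]].
  exists (1 - Rmin (d / 2) (1 / 2))%R.
  assert (0 < Rmin (d / 2) (1 / 2))%R by (apply Rmin_pos; lra).
  pose proof (Rmin_l (d / 2) (1 / 2)); pose proof (Rmin_r (d / 2) (1 / 2)).
  split; [apply H; lra|apply Hd; rewrite Rabs_left; lra]. }
split.
- destruct (Req_dec (Im (f 1%R)) 0) as [E|N]; [exact E|exfalso].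
  destruct (Happrox (Rabs (Im (f 1%R))) (Rabs_pos_lt _ N)) as [r [[H1 _] H2]].
  assert (H3 := Im_le_Cmod (f r - f 1%R)).
  unfold Cminus in H3 at 1; rewrite im_plus, im_opp, H1, Rplus_0_l, Rabs_Ropp in H3; lra.
- destruct (Rle_lt_dec 0 (Re (f 1%R))) as [E|N]; [exact E|exfalso].
  destruct (Happrox (- Re (f 1%R))%R) as [r [[_ H1] H2]]; [lra|].
  assert (H3 := re_le_Cmod (f r - f 1%R)).
  unfold Cminus in H3 at 1; rewrite re_plus, re_opp in H3.
  rewrite Rabs_pos_eq in H3; lra.
Qed.

Lemma Cdifferentiable_dilation (g : C -> C) (r : R) :
  (forall z, unit_disk z -> Cdifferentiable g z) -> (0 < r < 1)%R ->
  differentiable_on_closed_disk (fun u => g (RtoC r * u)).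
Proof.
intros Hg Hr z Hz; apply (Cdifferentiable_comp g (fun u => RtoC r * u)).
- apply Hg; unfold unit_disk; rewrite Cmod_mult, Cmod_R, Rabs_pos_eq by lra.
  pose proof (Cmod_ge_0 z); nra.
- apply (Cdifferentiable_mult (fun _ => RtoC r)); [apply Cdifferentiable_const|].
  apply Cdifferentiable_id.
Qed.

Lemma Pick_nonneg_open_disk (g : C -> C) (M : R) (z c : nat -> C) (n : nat) :
  (forall u, unit_disk u -> Cdifferentiable g u) ->
  (0 < M)%R ->
  (forall u, unit_disk u -> (Cmod (g u) <= M)%R) ->
  (forall i, (i <= n)%nat -> unit_disk (z i)) ->
  Cnonneg (RtoC (M ^ 2) * szego_gram z c n
           - szego_gram z (fun j => c j * Cconj (g (z j))) n).
Proof.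
intros Hg HM0 HM Hz.
set (d := fun r j => c j * Cconj (g (RtoC r * z j))).
set (f := fun r => RtoC (M ^ 2) * szego_gram z c n + - (1) * szego_gram z (d r) n).
replace (RtoC (M ^ 2) * szego_gram z c n
  - szego_gram z (fun j => c j * Cconj (g (z j))) n) with (f 1%R).
- apply Cnonneg_left_limit.
  + assert (Hd : forall j, (j <= n)%nat -> Ccontinuous (fun r => d r j) 1).
    { intros j Hj; apply Ccontinuous_mult; [apply Ccontinuous_const|apply Ccontinuous_conj].
      apply (Ccontinuous_comp g (fun r => RtoC r * z j)).
      - rewrite Cmult_1_l; auto.
      - apply Ccontinuous_mult; [|apply Ccontinuous_const].
        apply Ccontinuous_of_parts; [apply continuous_id|apply continuous_const]. }
    apply Ccontinuous_plus; [apply Ccontinuous_const|].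
    apply Ccontinuous_mult; [apply Ccontinuous_const|].
    apply (Ccontinuous_sum_n (fun i r => Cconj (d r i) * szego_comb z (d r) n (z i))).
    intros i Hi; apply Ccontinuous_mult; [now apply Ccontinuous_conj, Hd|].
    apply (Ccontinuous_sum_n (fun j r => d r j * szego (z i) (z j))).
    intros j Hj; apply Ccontinuous_mult; [now apply Hd|apply Ccontinuous_const].
  + intros r Hr.
    replace (f r) with (RtoC (M ^ 2) * szego_gram z c n - szego_gram z (d r) n)
      by (unfold f; ring).
    apply (Pick_nonneg (fun u => g (RtoC r * u))); auto.
    * now apply Cdifferentiable_dilation.
    * intros u Hu; apply HM; unfold unit_disk; rewrite Cmod_mult, Cmod_R, Rabs_pos_eq by lra.
      pose proof (Cmod_ge_0 u); nra.
- unfold f; replace (szego_gram z (d 1%R) n)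
    with (szego_gram z (fun j => c j * Cconj (g (z j))) n).
  + ring.
  + unfold szego_gram, szego_comb; apply Csum_ext; intros i _.
    unfold d; rewrite Cmult_1_l; f_equal.
    apply Csum_ext; intros j _; now rewrite Cmult_1_l.
Qed.

Lemma is_blaschke_id : is_blaschke (fun z => z).
Proof.
exists 0%R, (RtoC 0 :: nil); split; [simpl; lia|split].
- intros a [<-|[]]; unfold unit_disk; rewrite Cmod_0; lra.
- intros z _; unfold blaschke_product, Cexp_i; simpl.
  rewrite cos_0, sin_0, Cconj_RtoC; change (1%R, 0%R) with (RtoC 1).
  replace (1 - 0 * z) with (RtoC 1) by ring; field.
Qed.

Lemma bounded_holomorphic_psd (g : C -> C) :
  bounded_on_disk g -> holomorphic_on_disk g ->
  exists (M : R) (f : C -> C),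
    (0 < M)%R /\ is_blaschke f /\ psd_kernel_on_disk (Delta_kernel M g f).
Proof.
intros [B HB] Hg; exists (Rmax B 1), (fun z => z).
assert (HM : (0 < Rmax B 1)%R) by (pose proof (Rmax_r B 1); lra).
split; [exact HM|split; [apply is_blaschke_id|]].
intros n z c Hz; rewrite Delta_sum.
replace (alpha_sq (fun z => z)) with 1%R by (unfold alpha_sq; rewrite Cmod_0; field).
rewrite Rmult_1_r; apply Pick_nonneg_open_disk; auto.
- intros u Hu; now apply holomorphic_differentiable, Hg.
- intros u Hu; eapply Rle_trans; [now apply HB|apply Rmax_l].
Qed.

(** * From positivity to boundedness and holomorphy *)

(* 1 - |b_a(z)|^2 = (1 - |a|^2) (1 - |z|^2) / |1 - conj a z|^2 for a single factor b_a *)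
Lemma blaschke_factor_bound (a z : C) :
  unit_disk a -> unit_disk z ->
  (Cmod ((z - a) / (1 - Cconj a * z)) < 1)%R /\
  (1 - Cmod ((z - a) / (1 - Cconj a * z)) ^ 2
   <= (1 - Cmod z ^ 2) / (1 - Cmod a) ^ 2)%R.
Proof.
unfold unit_disk; intros Ha Hz.
assert (Hden : (1 - Cmod a <= Cmod (1 - Cconj a * z))%R).
{ eapply Rle_trans; [|apply Cmod_sub_ge].
  rewrite Cmod_1, Cmod_mult, Cmod_conj; pose proof (Cmod_ge_0 a); nra. }
assert (Hne : 1 - Cconj a * z <> 0) by (apply Cmod_gt_0; lra).
assert (Hz0 := Cmod_ge_0 z); assert (Ha0 := Cmod_ge_0 a).
assert (Hid : (Cmod (1 - Cconj a * z) ^ 2 - Cmod (z - a) ^ 2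
  = (1 - Cmod a ^ 2) * (1 - Cmod z ^ 2))%R).
{ rewrite !Cmod2_alt; destruct a, z; simpl; ring. }
rewrite Cmod_div by exact Hne.
set (p := Cmod (z - a)) in *; set (q := Cmod (1 - Cconj a * z)) in *.
assert (Hprod : (0 < (1 - Cmod a ^ 2) * (1 - Cmod z ^ 2))%R)
  by (apply Rmult_lt_0_compat; nra).
assert (Hp0 : (0 <= p)%R) by apply Cmod_ge_0.
assert (Hq2 : (0 < q ^ 2)%R) by nra.
split; [apply Rlt_div_l; nra|].
replace ((p / q) ^ 2)%R with (p ^ 2 / q ^ 2)%R by (field; lra).
replace (1 - p ^ 2 / q ^ 2)%R with ((q ^ 2 - p ^ 2) / q ^ 2)%R by (field; lra).
rewrite Hid; unfold Rdiv; apply Rmult_le_compat.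
- lra.
- left; now apply Rinv_0_lt_compat.
- assert (0 <= Cmod a ^ 2 * (1 - Cmod z ^ 2))%R by (apply Rmult_le_pos; nra); lra.
- apply Rinv_le_contravar; [apply pow_lt; lra|apply pow_incr; lra].
Qed.

Lemma blaschke_product_bound (zeros : list C) :
  (forall a, In a zeros -> unit_disk a) ->
  exists K, (0 <= K)%R /\ forall theta z, unit_disk z ->
    (Cmod (blaschke_product theta zeros z) ^ 2 <= 1)%R /\
    (1 - Cmod (blaschke_product theta zeros z) ^ 2 <= K * (1 - Cmod z ^ 2))%R.
Proof.
intros H.
assert (HK : exists K, (0 <= K)%R /\ forall z, unit_disk z ->
  let P := fold_right Cmult 1 (map (fun a => (z - a) / (1 - Cconj a * z)) zeros) in
  (Cmod P ^ 2 <= 1)%R /\ (1 - Cmod P ^ 2 <= K * (1 - Cmod z ^ 2))%R).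
{ induction zeros as [|a zeros IH].
  - exists 0%R; split; [lra|]; intros z Hz P; unfold P; simpl; rewrite Cmod_1; lra.
  - destruct IH as [K [HK0 HK]]; [intros b Hb; apply H; now right|].
    assert (Ha : unit_disk a) by (apply H; now left).
    assert (Ha1 : (0 < (1 - Cmod a) ^ 2)%R) by (apply pow_lt; unfold unit_disk in Ha; lra).
    exists (K + / (1 - Cmod a) ^ 2)%R; split.
    { apply Rinv_0_lt_compat in Ha1; lra. }
    intros z Hz P; unfold P; simpl fold_right; simpl map.
    destruct (HK z Hz) as [H1 H2]; destruct (blaschke_factor_bound a z Ha Hz) as [H3 H4].
    rewrite Cmod_mult, Rpow_mult_distr.
    assert (H5 : (Cmod ((z - a) / (1 - Cconj a * z)) ^ 2 <= 1)%R)
      by (pose proof (Cmod_ge_0 ((z - a) / (1 - Cconj a * z))); nra).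
    set (x := (Cmod ((z - a) / (1 - Cconj a * z)) ^ 2)%R) in *.
    set (y := (Cmod (fold_right _ _ _) ^ 2)%R) in *.
    assert (0 <= x)%R by apply pow2_ge_0.
    assert (0 <= y)%R by apply pow2_ge_0.
    unfold Rdiv in H4; split; nra. }
destruct HK as [K [HK0 HK]]; exists K; split; [exact HK0|].
intros theta z Hz; unfold blaschke_product; rewrite Cmod_mult, Cexp_i_Cmod, Rmult_1_l.
now apply HK.
Qed.

Lemma blaschke_unit_disk (f : C -> C) (z : C) : is_blaschke f -> unit_disk z -> unit_disk (f z).
Proof.
intros (theta & zeros & Hlen & Hz & Hf) Hzd; rewrite Hf by exact Hzd.
destruct zeros as [|a zeros]; [simpl in Hlen; lia|].
destruct (blaschke_product_bound zeros) as [K [_ HK]]; [intros b Hb; apply Hz; now right|].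
destruct (HK theta z Hzd) as [H1 _]; unfold blaschke_product in *; simpl fold_right; simpl map.
rewrite Cmod_mult, Cexp_i_Cmod, Rmult_1_l in H1.
unfold unit_disk; rewrite Cmod_mult, Cexp_i_Cmod, Rmult_1_l, Cmod_mult.
set (y := Cmod (fold_right _ _ _)) in *.
assert (Hy : (0 <= y)%R) by apply Cmod_ge_0.
destruct (blaschke_factor_bound a z) as [Hx _]; [apply Hz; now left|exact Hzd|].
pose proof (Cmod_ge_0 ((z - a) / (1 - Cconj a * z))); nra.
Qed.

Lemma alpha_sq_ge_0 (f : C -> C) : is_blaschke f -> (0 <= alpha_sq f)%R.
Proof.
intros Hf; assert (H := blaschke_unit_disk f 0 Hf).
assert (H0 : unit_disk 0) by (unfold unit_disk; rewrite Cmod_0; lra).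
specialize (H H0); unfold unit_disk in H; pose proof (Cmod_ge_0 (f 0)).
unfold alpha_sq; apply Rdiv_le_0_compat; lra.
Qed.

Lemma psd_bounded (M : R) (g f : C -> C) :
  is_blaschke f -> psd_kernel_on_disk (Delta_kernel M g f) -> bounded_on_disk g.
Proof.
intros Hf Hpsd.
destruct Hf as (theta & zeros & Hlen & Hzeros & Hfz).
assert (Hf : is_blaschke f) by (exists theta, zeros; auto).
destruct (blaschke_product_bound zeros Hzeros) as [K [HK0 HK]].
set (A := (M ^ 2 * alpha_sq f)%R).
assert (HA : (0 <= A)%R)
  by (apply Rmult_le_pos; [apply pow2_ge_0|now apply alpha_sq_ge_0]).
exists (A * K + 1)%R; intros z Hz.
assert (Hfd := blaschke_unit_disk f z Hf Hz).
destruct (HK theta z Hz) as [_ H1]; rewrite <- Hfz in H1 by exact Hz.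
destruct (Hpsd 0%nat (fun _ => z) (fun _ => 1)) as [_ H2]; [auto|].
rewrite !sum_O in H2.
assert (Hdiag : forall w, unit_disk w -> szego w w = RtoC (/ (1 - Cmod w ^ 2))).
{ intros w Hw; unfold szego; rewrite <- Cmod2_conj, <- RtoC_minus; symmetry; apply RtoC_inv.
  unfold unit_disk in Hw; pose proof (Cmod_ge_0 w); apply Rgt_not_eq; nra. }
unfold Delta_kernel in H2; rewrite !Hdiag in H2 by assumption; fold A in H2.
replace ((RtoC A * RtoC (/ (1 - Cmod z ^ 2))
  - g z * RtoC (/ (1 - Cmod (f z) ^ 2)) * Cconj (g z)) * 1 * Cconj 1)
  with (RtoC (A * / (1 - Cmod z ^ 2) - Cmod (g z) ^ 2 * / (1 - Cmod (f z) ^ 2))) in H2.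
2:{ rewrite RtoC_minus, !RtoC_mult, Cmod2_conj, Cconj_RtoC; ring. }
change (0 <= A * / (1 - Cmod z ^ 2) - Cmod (g z) ^ 2 * / (1 - Cmod (f z) ^ 2))%R in H2.
unfold unit_disk in Hz, Hfd.
assert (Hx : (0 < 1 - Cmod z ^ 2)%R) by (pose proof (Cmod_ge_0 z); nra).
assert (Hy : (0 < 1 - Cmod (f z) ^ 2)%R) by (pose proof (Cmod_ge_0 (f z)); nra).
set (x := (1 - Cmod z ^ 2)%R) in *; set (y := (1 - Cmod (f z) ^ 2)%R) in *.
set (G := Cmod (g z)) in *.
assert (H3 : (G ^ 2 * x <= A * y)%R).
{ apply (Rmult_le_compat_r (x * y)) in H2; [|nra].
  replace ((A * / x - G ^ 2 * / y) * (x * y))%R with (A * y - G ^ 2 * x)%R in H2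
    by (field; lra).
  lra. }
assert (H4 : (G ^ 2 <= A * K)%R).
{ apply (Rmult_le_reg_r x); [exact Hx|]; nra. }
assert (0 <= A * K)%R by now apply Rmult_le_pos.
destruct (Rle_lt_dec G (A * K + 1)) as [E|N]; [exact E|nra].
Qed.

Lemma psd_functional_bound (M : R) (g f : C -> C) (z c : nat -> C) (n : nat) :
  (forall u, unit_disk u -> unit_disk (f u)) ->
  psd_kernel_on_disk (Delta_kernel M g f) ->
  (forall i, (i <= n)%nat -> unit_disk (z i)) ->
  (Cmod (sum_n (fun i => Cconj (c i) * g (z i))%C n) ^ 2
   <= M ^ 2 * alpha_sq f * Re (szego_gram z c n))%R.
Proof.
intros Hf Hpsd Hz.
destruct (Hpsd n z c Hz) as [_ H]; rewrite Delta_sum in H.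
set (d := fun j => c j * Cconj (g (z j))) in H.
assert (H1 := szego_gram_ge (fun i => f (z i)) d n (fun i Hi => Hf _ (Hz i Hi))).
replace (sum_n (fun i => Cconj (d i)) n) with (sum_n (fun i => Cconj (c i) * g (z i)) n) in H1.
2:{ apply Csum_ext; intros i _; unfold d; now rewrite Cmult_conj, Cconj_conj. }
set (S := Cmod (sum_n (fun i => Cconj (c i) * g (z i)) n)) in *.
set (X := szego_gram z c n) in *; set (Y := szego_gram (fun i => f (z i)) d n) in *.
set (A := (M ^ 2 * alpha_sq f)%R) in *.
change (0 <= A * Re X - 0 * Im X + - Re Y)%R in H; lra.
Qed.

Lemma Cdifferentiable_of_Lipschitz_slope (g : C -> C) (z : C) (d L : R) :
  (0 < d)%R -> (0 <= L)%R ->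
  (forall h k : C, h <> 0 -> k <> 0 -> (Cmod h <= d)%R -> (Cmod k <= d)%R ->
     (Cmod ((g (z + h)%C - g z) / h - (g (z + k)%C - g z) / k) <= L * Cmod (h - k))%R) ->
  Cdifferentiable g z.
Proof.
intros Hd HL H.
set (D := fun h => (g (z + h) - g z) / h) in *.
assert (HD : forall r s, (0 < r <= d)%R -> (0 < s <= d)%R ->
  (Cmod (D (RtoC r) - D (RtoC s)) <= L * Rabs (r - s))%R).
{ intros r s Hr Hs; rewrite <- Cmod_R, RtoC_minus; apply H.
  1,2: intros E; apply RtoC_inj in E; lra.
  all: rewrite Cmod_R, Rabs_pos_eq; lra. }
assert (Hlim : exists l : C, forall eps, (0 < eps)%R ->
  exists delta, (0 < delta)%R /\
  forall r, (0 < r < delta)%R -> (Cmod (D (RtoC r) - l) <= eps)%R).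
{ assert (Hre : forall phi : C -> R, (forall x y, (Rabs (phi x - phi y) <= Cmod (x - y))%R) ->
    exists l : R, filterlim (fun r => phi (D (RtoC r))) (at_right 0) (locally l)).
  { intros phi Hphi.
    apply (filterlim_locally_cauchy (U := R_CompleteSpace) (F := at_right 0)).
    intros eps.
    assert (HL1 : (0 < L + 1)%R) by lra.
    set (rho := Rmin d (eps / (L + 1))).
    assert (Hrho : (0 < rho)%R)
      by (apply Rmin_pos; [exact Hd|apply Rdiv_lt_0_compat; [apply cond_pos|exact HL1]]).
    assert (Hrho1 := Rmin_l d (eps / (L + 1))); fold rho in Hrho1.
    assert (Hrho2 := Rmin_r d (eps / (L + 1))); fold rho in Hrho2.
    apply Rle_div_r in Hrho2; [|exact HL1].
    exists (fun r => 0 < r < rho)%R; split.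
    - exists (mkposreal _ Hrho); intros r Hr Hr0; split; [exact Hr0|].
      change (Rabs (r - 0) < rho)%R in Hr; rewrite Rminus_0_r in Hr.
      eapply Rle_lt_trans; [apply Rle_abs|exact Hr].
    - intros u v Hu Hv.
      change (Rabs (phi (D (RtoC v)) - phi (D (RtoC u))) < eps)%R.
      eapply Rle_lt_trans; [apply Hphi|].
      eapply Rle_lt_trans; [apply HD; lra|].
      assert (Rabs (v - u) < rho)%R by (apply Rabs_def1; lra).
      pose proof (Rabs_pos (v - u)).
      nra. }
  destruct (Hre Re) as [l1 H1].
  { intros x y; exact (re_le_Cmod (x - y)). }
  destruct (Hre Im) as [l2 H2].
  { intros x y; exact (Im_le_Cmod (x - y)). }
  exists (l1, l2); intros eps Heps.
  assert (He : (0 < eps / 2)%R) by lra.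
  destruct (H1 _ (locally_ball l1 (mkposreal _ He))) as [d1 Hd1].
  destruct (H2 _ (locally_ball l2 (mkposreal _ He))) as [d2 Hd2].
  exists (Rmin d1 d2); split; [apply Rmin_pos; apply cond_pos|]; intros r Hr.
  pose proof (Rmin_l d1 d2); pose proof (Rmin_r d1 d2).
  assert (B1 : (Rabs (Re (D (RtoC r)) - l1) < eps / 2)%R).
  { apply (Hd1 r); [|lra]; change (Rabs (r - 0) < d1)%R.
    rewrite Rminus_0_r, Rabs_pos_eq; lra. }
  assert (B2 : (Rabs (Im (D (RtoC r)) - l2) < eps / 2)%R).
  { apply (Hd2 r); [|lra]; change (Rabs (r - 0) < d2)%R.
    rewrite Rminus_0_r, Rabs_pos_eq; lra. }
  eapply Rle_trans; [apply Cmod_le_Re_Im|].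
  change (Rabs (Re (D (RtoC r)) - l1) + Rabs (Im (D (RtoC r)) - l2) <= eps)%R; lra. }
destruct Hlim as [l Hl].
assert (HDl : forall h : C, h <> 0 -> (Cmod h <= d)%R -> (Cmod (D h - l) <= L * Cmod h)%R).
{ intros h Hh Hhd; apply le_epsilon; intros eps Heps.
  assert (HL1 : (0 < L + 1)%R) by lra.
  destruct (Hl (eps / 2)%R) as [delta [Hdelta0 Hdelta]]; [lra|].
  set (rho := Rmin (Rmin d delta) (eps / 2 / (L + 1))).
  assert (Hrho : (0 < rho)%R)
    by (apply Rmin_pos; [apply Rmin_pos; lra|apply Rdiv_lt_0_compat; lra]).
  assert (Hrho1 := Rmin_l (Rmin d delta) (eps / 2 / (L + 1))); fold rho in Hrho1.
  assert (Hrho2 := Rmin_r (Rmin d delta) (eps / 2 / (L + 1))); fold rho in Hrho2.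
  pose proof (Rmin_l d delta); pose proof (Rmin_r d delta).
  apply Rle_div_r in Hrho2; [|exact HL1].
  assert (B1 := Hdelta (rho / 2)%R ltac:(lra)).
  assert (B2 : (Cmod (D h - D (RtoC (rho / 2))) <= L * Cmod (h - RtoC (rho / 2)))%R).
  { apply H; [exact Hh| |exact Hhd|].
    - intros E; apply RtoC_inj in E; lra.
    - rewrite Cmod_R, Rabs_pos_eq; lra. }
  assert (B3 : (Cmod (h - RtoC (rho / 2)) <= Cmod h + rho / 2)%R).
  { unfold Cminus; eapply Rle_trans; [apply Cmod_triangle|].
    rewrite Cmod_opp, Cmod_R, (Rabs_pos_eq (rho / 2)); lra. }
  replace (D h - l) with ((D h - D (RtoC (rho / 2))) + (D (RtoC (rho / 2)) - l)) by ring.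
  eapply Rle_trans; [apply Cmod_triangle|].
  nra. }
apply Cdifferentiable_eps; exists l; intros eps Heps.
assert (HL1 : (0 < L + 1)%R) by lra.
exists (Rmin d (eps / (L + 1))); split.
{ apply Rmin_pos; [exact Hd|now apply Rdiv_lt_0_compat]. }
intros u Hu.
assert (Hu1 := Rlt_le_trans _ _ _ Hu (Rmin_l _ _)).
assert (Hu2 := Rlt_le_trans _ _ _ Hu (Rmin_r _ _)).
apply Rlt_div_r in Hu2; [|exact HL1].
destruct (Req_dec (Cmod (u - z)) 0) as [E|N].
- apply Cmod_eq_0 in E.
  replace u with (u - z + z) by ring; rewrite E.
  replace (g (0 + z) - g z - l * (0 + z - z)) with (RtoC 0)
    by (replace (0 + z) with z by ring; ring).
  replace (0 + z - z) with (RtoC 0) by ring; rewrite Cmod_0; lra.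
- assert (Hne : u - z <> 0) by (intros E; apply N; rewrite E; apply Cmod_0).
  replace (g u - g z - l * (u - z)) with ((D (u - z) - l) * (u - z)).
  2:{ unfold D; replace (z + (u - z)) with u by ring; field; exact Hne. }
  rewrite Cmod_mult; apply Rmult_le_compat_r; [apply Cmod_ge_0|].
  eapply Rle_trans; [apply HDl; [exact Hne|lra]|].
  pose proof (Cmod_ge_0 (u - z)); nra.
Qed.

Lemma one_sub_circle_ge (t d : R) (y : C) :
  (Cmod y <= 1 - d)%R -> (d <= Cmod (1 - Cexp_i t * y))%R.
Proof.
intros Hy; eapply Rle_trans; [|apply Cmod_sub_ge].
rewrite Cmod_1, Cmod_mult, Cexp_i_Cmod; lra.
Qed.

(* The three coefficients select the difference of two slopes of g at z; on the kernel
   side they give a second-order divided difference of x |-> 1 / (1 - u x). *)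
Lemma psd_slope_Lipschitz (M : R) (g f : C -> C) (z h k : C) (d : R) :
  (forall u, unit_disk u -> unit_disk (f u)) ->
  (0 <= M ^ 2 * alpha_sq f)%R ->
  psd_kernel_on_disk (Delta_kernel M g f) ->
  (0 < d)%R -> (Cmod z + d <= 1 - d)%R ->
  h <> 0 -> k <> 0 -> (Cmod h <= d)%R -> (Cmod k <= d)%R ->
  (Cmod ((g (z + h) - g z) / h - (g (z + k) - g z) / k)%C
   <= sqrt (M ^ 2 * alpha_sq f * 2) / d ^ 3 * Cmod (h - k))%R.
Proof.
intros Hf HA Hpsd Hd Hz Hh Hk Hhd Hkd.
set (w := fun i : nat => match i with 0%nat => z | 1%nat => z + h | _ => z + k end).
set (c := fun i : nat => Cconj (match i with
  0%nat => / k - / h | 1%nat => / h | _ => - / k end)).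
assert (Hwd : forall i, (Cmod (w i) <= 1 - d)%R).
{ intros [|[|i]]; simpl.
  - lra.
  - eapply Rle_trans; [apply Cmod_triangle|lra].
  - eapply Rle_trans; [apply Cmod_triangle|lra]. }
assert (Hw : forall i, (i <= 2)%nat -> unit_disk (w i))
  by (intros i _; unfold unit_disk; specialize (Hwd i); lra).
assert (H1 := psd_functional_bound M g f w c 2 Hf Hpsd Hw).
assert (H2 : (Re (szego_gram w c 2) <= 2 * (Cmod (h - k) / d ^ 3) ^ 2)%R).
{ apply szego_gram_le; [exact Hw|]; intros t.
  set (u := Cexp_i t).
  assert (Hge : forall i, (d <= Cmod (1 - u * Cconj (w i)))%R)
    by (intros i; apply one_sub_circle_ge; rewrite Cmod_conj; apply Hwd).
  assert (Hne : forall i, 1 - u * Cconj (w i) <> 0)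
    by (intros i; apply Cmod_gt_0; specialize (Hge i); lra).
  assert (Hh' : Cconj h <> 0) by (apply Cmod_gt_0; rewrite Cmod_conj; now apply Cmod_gt_0).
  assert (Hk' : Cconj k <> 0) by (apply Cmod_gt_0; rewrite Cmod_conj; now apply Cmod_gt_0).
  assert (E : szego_comb w c 2 u = u * u * Cconj (h - k) /
    ((1 - u * Cconj (w 0%nat)) * (1 - u * Cconj (w 1%nat)) * (1 - u * Cconj (w 2%nat)))).
  { unfold szego_comb; rewrite !sum_Sn, sum_O.
    change (c 0%nat * szego u (w 0%nat) + c 1%nat * szego u (w 1%nat)
      + c 2%nat * szego u (w 2%nat) = u * u * Cconj (h - k) /
      ((1 - u * Cconj (w 0%nat)) * (1 - u * Cconj (w 1%nat)) * (1 - u * Cconj (w 2%nat)))).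
    pose proof (Hne 0%nat) as N0; pose proof (Hne 1%nat) as N1; pose proof (Hne 2%nat) as N2.
    unfold szego, c; simpl in *.
    rewrite Cminus_conj, Copp_conj, !Cinv_conj, Cplus_conj, (Cplus_conj z k), Cminus_conj in *
      by assumption.
    field; auto. }
  rewrite E, Cmod_div by (repeat apply Cmult_neq_0; apply Hne).
  rewrite !Cmod_mult, Cmod_conj; unfold u at 1 2; rewrite !Cexp_i_Cmod, !Rmult_1_l.
  unfold Rdiv; apply Rmult_le_compat_l; [apply Cmod_ge_0|].
  apply Rinv_le_contravar; [now apply pow_lt|].
  replace (d ^ 3)%R with (d * d * d)%R by ring.
  repeat apply Rmult_le_compat; try apply Hge; try lra; nra. }
set (S := sum_n (fun i => Cconj (c i) * g (w i)) 2) in H1.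
assert (E : S = (g (z + h) - g z) / h - (g (z + k) - g z) / k).
{ unfold S; rewrite !sum_Sn, sum_O.
  change (Cconj (c 0%nat) * g (w 0%nat) + Cconj (c 1%nat) * g (w 1%nat)
    + Cconj (c 2%nat) * g (w 2%nat) = (g (z + h) - g z) / h - (g (z + k) - g z) / k).
  unfold c; rewrite !Cconj_conj; simpl; field; auto. }
rewrite <- E.
assert (Hr : (0 <= Cmod (h - k) / d ^ 3)%R)
  by (apply Rdiv_le_0_compat; [apply Cmod_ge_0|now apply pow_lt]).
set (A := (M ^ 2 * alpha_sq f)%R) in *.
replace (sqrt (A * 2) / d ^ 3 * Cmod (h - k))%R with (sqrt (A * 2) * (Cmod (h - k) / d ^ 3))%R
  by (unfold Rdiv; ring).
apply Rsqr_incr_0_var; [|apply Rmult_le_pos; [apply sqrt_pos|exact Hr]].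
rewrite Rsqr_mult, Rsqr_sqrt by lra.
rewrite <- !Rsqr_pow2 in *.
set (X := Re (szego_gram w c 2)) in *.
eapply Rle_trans; [exact H1|].
eapply Rle_trans; [apply Rmult_le_compat_l; [exact HA|exact H2]|].
right; ring.
Qed.

Lemma psd_holomorphic (M : R) (g f : C -> C) :
  is_blaschke f -> psd_kernel_on_disk (Delta_kernel M g f) -> holomorphic_on_disk g.
Proof.
intros Hf Hpsd z Hz; apply holomorphic_differentiable.
assert (HA : (0 <= M ^ 2 * alpha_sq f)%R)
  by (apply Rmult_le_pos; [apply pow2_ge_0|now apply alpha_sq_ge_0]).
unfold unit_disk in Hz.
set (d := ((1 - Cmod z) / 2)%R).
assert (Hd : (0 < d)%R) by (unfold d; lra).
apply Cdifferentiable_of_Lipschitz_slope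
  with (d := d) (L := (sqrt (M ^ 2 * alpha_sq f * 2) / d ^ 3)%R).
- exact Hd.
- apply Rdiv_le_0_compat; [apply sqrt_pos|now apply pow_lt].
- intros h k Hh Hk Hhd Hkd; apply psd_slope_Lipschitz; auto.
  + intros u; now apply blaschke_unit_disk.
  + unfold d; lra.
Qed.

Theorem theoremB (g : C -> C) :
  (bounded_on_disk g /\ holomorphic_on_disk g) <->
  (exists (M : R) (f : C -> C),
     (0 < M)%R /\ is_blaschke f /\ psd_kernel_on_disk (Delta_kernel M g f)).
Proof.
split.
- intros [Hb Hg]; now apply bounded_holomorphic_psd.
- intros (M & f & _ & Hf & Hpsd); split.
  + now apply psd_bounded with M f.
  + now apply psd_holomorphic with M f.
Qed.
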